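(* Let $R$ be any associative ring with $1$, let $F_{\aleph_0}={}_RR^{(\omega)}$ be the free left $R$-module of rank $\aleph_0$, and let $T_{\aleph_0}$ be its complete first-order theory. Then the following are equivalent. \begin{itemize} \item[(i)] $R\text{-Mod}$ has the dcc on all pp formulas, of any arity $l(\bar x)$, of the form $A|\bar x$ where $A$ is a matrix over $R$ with $l(\bar x)$ many rows. \item[(ii)] All flat modules are Mittag-Leffler. \item[(ii)$_T$] All flat models of $T_{\aleph_0}$ are Mittag-Leffler. \item[(iii)] All countably generated flat modules are projective. \item[(iii)$_T$] All countably generated flat models of $T_{\aleph_0}$ are projective. \item[(iv)] Every countably generated flat module is isomorphic to a direct summand of $F_{\aleph_0}$. \item[(iv)$_T$] Every countably generated flat model of $T_{\aleph_0}$ is isomorphic to a direct summand of $F_{\aleph_0}$ that is at the same time an elementary substructure. \item[(v)] Every countably generated flat module is purely embedded in $F_{\aleph_0}$. \item[(v)$_T$] Every countably generated flat model of $T_{\aleph_0}$ is elementarily embedded in $F_{\aleph_0}$. \item[(vi)] $R$ is left perfect, i.e., all flat (left) modules are projective. Equivalently, $R$ has the dcc on principal right ideals. \end{itemize} Moreover, given an infinite cardinal $\kappa$, everywhere above ''countably generated'' can be replaced by ''$\kappa$-generated'' if at the same time $F_{\aleph_0}$, as the module into which these modules embed or of which they are direct summands, is replaced by $F_{\aleph_0}^{(\kappa)}$.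
   Context: All modules are unitary left $R$-modules; $R\text{-Mod}$ is the class of all of them. $M^{(\kappa)}$ denotes the direct sum of $\kappa$ copies of $M$. A module is $\kappa$-generated if it has a generating set of at most $\kappa$ elements. Modules are first-order structures in the language $L$ with $0$, $+$ and a unary function symbol for each $r\in R$. A positive primitive (pp) formula in variables $\bar x$ is one of the form $\exists\bar y\,(A\bar y=B\bar x)$ with $A,B$ matrices over $R$ of matching sizes; tuples are regarded as column vectors. The formula $A|\bar x$ is $\exists\bar y\,(A\bar y=\bar x)$. For pp formulas of the same arity, $\varphi\le\psi$ means $\varphi(M)\subseteq\psi(M)$ for every $M\in R\text{-Mod}$. The pp type $\mathrm{pp}_M(\bar a)$ of a finite tuple $\bar a$ in $M$ is the set of all pp formulas satisfied by $\bar a$ in $M$. It is finitely generated if it contains a formula $\varphi$ with $\varphi\le\psi$ for every $\psi\in\mathrm{pp}_M(\bar a)$. A module is Mittag-Leffler if the pp type of every finite tuple in it is finitely generated. A monomorphism is pure if it preserves pp types of all finite tuples. $R\text{-Mod}$ has the dcc on a set $\Gamma$ of pp formulas if for every module $K$ and every descending chain $\gamma_0(\bar x)\ge\gamma_1(\bar x)\ge\dots$ of formulas from $\Gamma$ of the same arity, the descending chain of subgroups $\gamma_i(K)$ of $K^{l(\bar x)}$ stabilizes. *)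

(* Defs.v *)
From HB Require Import structures.
From mathcomp Require Import all_boot all_order all_algebra generic_quotient.
From mathcomp Require Import boolp classical_sets functions cardinality.

Set Implicit Arguments.
Unset Strict Implicit.
Unset Printing Implicit Defensive.

Import GRing.Theory.
Local Open Scope classical_set_scope.
Local Open Scope card_scope.
Local Open Scope ring_scope.

(* Rings are [pzRingType]: associative, with 1, the zero ring being allowed.
   Left R-modules are [lmodType R]; right R-modules are left modules over the
   converse ring [R^c]. *)

Section DirectSum.
Variables (R : pzRingType) (I : Type) (M : lmodType R).

Definition finsupp : {pred I -> M} :=
  fun f => `[< finite_set [set i | f i != 0] >].

Lemma finsupp_submod : submod_closed finsupp.
Proof.
split=> [|a f g /asboolP ff /asboolP fg]; apply/asboolP.
  by apply: (@sub_finite_set _ _ set0) => // i /=; rewrite eqxx.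
apply: (@sub_finite_set _ _
  ([set i | f i != 0] `|` [set i | g i != 0])); last by rewrite finite_setU.
move=> i; rewrite /= [X in X != 0](_ : _ = a *: f i + g i) //.
have [-> | ] := eqVneq (f i) 0; last by left.
by rewrite scaler0 add0r; right.
Qed.

HB.instance Definition _ := GRing.isSubmodClosed.Build R (I -> M) finsupp
  finsupp_submod.

(* The direct sum of copies of M indexed by I; the cardinal of I is the number
   of copies. *)
Definition dsum := {f : I -> M | finsupp f}.

HB.instance Definition _ := SubChoice.on dsum.
HB.instance Definition _ := [SubChoice_isSubLmodule of dsum by <:].

End DirectSum.

Definition free_aleph0 (R : pzRingType) : lmodType R := dsum nat R^o.

Section Submodule.
Variables (R : pzRingType) (M : lmodType R) (S : submodClosed M).

Definition submod := {x : M | x \in S}.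

HB.instance Definition _ := SubChoice.on submod.
HB.instance Definition _ := [SubChoice_isSubLmodule of submod by <:].

End Submodule.

Section Modules.
Variable R : pzRingType.
Implicit Types M N : lmodType R.

Definition isomorphic M N := exists f : {linear M -> N}, bijective f.

Definition direct_summand N (S : submodClosed N) :=
  exists S' : submodClosed N,
    (forall x, x \in S -> x \in S' -> x = 0) /\
    (forall x, exists s s', [/\ s \in S, s' \in S' & x = s + s']).

Definition generates M (X : set M) :=
  forall x : M, exists (n : nat) (c : 'I_n -> R) (g : 'I_n -> M),
    (forall i, X (g i)) /\ x = \sum_(i < n) c i *: g i.

(* Generation by at most |K| elements; a type K stands for its cardinal. *)
Definition card_generated (K : Type) M :=
  exists X : set M, X #<= [set: K] /\ generates X.

Definition projective M :=
  forall (A B : lmodType R) (g : {linear A -> B}) (h : {linear M -> B}),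
    (forall b, exists a, g a = b) ->
    exists h' : {linear M -> A}, forall x, g (h' x) = h x.

End Modules.

Section Tensor.
Variables (R : pzRingType) (A : lmodType R^c) (M : lmodType R).

(* The list [:: (a1, m1); ...; (an, mn)] stands for the sum of the ai (x) mi,
   and [tensor_eq] is the congruence, on the free commutative monoid on A * M,
   that is generated by the relations of the tensor product. The quotient is a
   group, as (-a, m) is inverse to (a, m), hence it is the tensor product. *)
Inductive tensor_eq : seq (A * M) -> seq (A * M) -> Prop :=
| tensor_refl s : tensor_eq s s
| tensor_sym s t : tensor_eq s t -> tensor_eq t s
| tensor_trans s t u : tensor_eq s t -> tensor_eq t u -> tensor_eq s u
| tensor_cat s s' t t' :
    tensor_eq s s' -> tensor_eq t t' -> tensor_eq (s ++ t) (s' ++ t')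
| tensor_comm s t : tensor_eq (s ++ t) (t ++ s)
| tensor_0l m : tensor_eq [:: (0, m)] [::]
| tensor_Dl a b m : tensor_eq [:: (a + b, m)] [:: (a, m); (b, m)]
| tensor_Dr a m n : tensor_eq [:: (a, m + n)] [:: (a, m); (a, n)]
| tensor_Z a (r : R) m : tensor_eq [:: ((r : R^c) *: a, m)] [:: (a, r *: m)].

Definition tensor_rel : rel (seq (A * M)) := fun s t => `[< tensor_eq s t >].

Lemma tensor_rel_refl : reflexive tensor_rel.
Proof. by move=> s; apply/asboolP/tensor_refl. Qed.

Lemma tensor_rel_sym : symmetric tensor_rel.
Proof. by move=> s t; apply/asboolP/asboolP; apply: tensor_sym. Qed.

Lemma tensor_rel_trans : transitive tensor_rel.
Proof.
by move=> t s u /asboolP st /asboolP tu; apply/asboolP/(tensor_trans st).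
Qed.

Canonical tensor_equiv :=
  EquivRel tensor_rel tensor_rel_refl tensor_rel_sym tensor_rel_trans.

Definition tensor := {eq_quot tensor_equiv}%qT.

Definition tensor_class (s : seq (A * M)) : tensor := \pi_tensor%qT s.

Lemma tensor_classP s t : tensor_class s = tensor_class t <-> tensor_eq s t.
Proof. by split=> [/eqquotP/asboolP|st]; last apply/eqquotP/asboolP. Qed.

End Tensor.

Section Flat.
Variable R : pzRingType.

(* f (x) M, computed on a representative; [tensor_map_class] shows that the
   choice of the latter is irrelevant. *)
Definition tensor_map (A B : lmodType R^c) (f : {linear A -> B})
    (M : lmodType R) (x : tensor A M) : tensor B M :=
  tensor_class [seq (f p.1, p.2) | p <- repr x].

Lemma tensor_map_eq (A B : lmodType R^c) (f : {linear A -> B})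
    (M : lmodType R) (s t : seq (A * M)) : tensor_eq s t ->
  tensor_eq [seq (f p.1, p.2) | p <- s] [seq (f p.1, p.2) | p <- t].
Proof.
elim=> {s t} [s|s t _|s t u _ + _|s s' t t' _ + _|s t|m|a b m|a m n|a r m] /=.
- exact: tensor_refl.
- exact: tensor_sym.
- exact: tensor_trans.
- by rewrite !map_cat; apply: tensor_cat.
- by rewrite !map_cat; apply: tensor_comm.
- by rewrite linear0; apply: tensor_0l.
- by rewrite linearD; apply: tensor_Dl.
- exact: tensor_Dr.
- by rewrite linearZ; apply: tensor_Z.
Qed.

Lemma tensor_map_class (A B : lmodType R^c) (f : {linear A -> B})
    (M : lmodType R) (s : seq (A * M)) :
  tensor_map f (tensor_class s) = tensor_class [seq (f p.1, p.2) | p <- s].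
Proof.
apply/tensor_classP/tensor_map_eq/tensor_classP.
by rewrite /tensor_class reprK.
Qed.

Definition flat (M : lmodType R) :=
  forall (A B : lmodType R^c) (f : {linear A -> B}),
    injective f -> injective (@tensor_map A B f M).

Definition left_perfect := forall M : lmodType R, flat M -> projective M.

Definition principal_right_ideal (a : R) : set R :=
  [set x | exists r, x = a * r].

Definition dcc_principal_right_ideals :=
  forall a : nat -> R,
    (forall i,
      principal_right_ideal (a i.+1) `<=` principal_right_ideal (a i)) ->
    exists n, forall i, (n <= i)%N ->
      principal_right_ideal (a i) = principal_right_ideal (a n).

End Flat.

(* The formula  exists y, A y = B x  in the n variables x. *)
Record pp (R : pzRingType) (n : nat) := PP {
  pp_eqs : nat;
  pp_bound : nat;
  pp_A : 'M[R]_(pp_eqs, pp_bound);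
  pp_B : 'M[R]_(pp_eqs, n) }.

Section PP.
Variable R : pzRingType.
Implicit Types M N : lmodType R.

Definition mx_app M (m n : nat) (A : 'M[R]_(m, n)) (x : 'I_n -> M) :
  'I_m -> M := fun i => \sum_(j < n) A i j *: x j.

Definition pp_sol n (phi : pp R n) M : set ('I_n -> M) :=
  [set x | exists y : 'I_(pp_bound phi) -> M,
             mx_app (pp_A phi) y = mx_app (pp_B phi) x].

Arguments pp_sol {n} phi M.

Definition pp_le n (phi psi : pp R n) :=
  forall M, pp_sol phi M `<=` pp_sol psi M.

Definition pp_type M n (a : 'I_n -> M) : set (pp R n) :=
  [set phi | pp_sol phi M a].

Definition fg_pp_type n (p : set (pp R n)) :=
  exists2 phi, p phi & forall psi, p psi -> pp_le phi psi.

Definition mittag_leffler M :=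
  forall n (a : 'I_n -> M), fg_pp_type (pp_type a).

Definition pure_mono M N (f : {linear M -> N}) :=
  injective f /\ forall n (a : 'I_n -> M), pp_type (f \o a) = pp_type a.

(* The formula A | x, with matrix B = 1. *)
Definition pp_dvd n k (A : 'M[R]_(n, k)) : pp R n := PP A 1%:M.

Definition dvd_formulas n : set (pp R n) :=
  [set phi | exists k (A : 'M[R]_(n, k)), phi = pp_dvd A].

Definition dcc_pp (Gamma : forall n, set (pp R n)) :=
  forall K n (gamma : nat -> pp R n),
    (forall i, Gamma n (gamma i)) ->
    (forall i, pp_le (gamma i.+1) (gamma i)) ->
    exists m, forall i, (m <= i)%N ->
      pp_sol (gamma i) K = pp_sol (gamma m) K.

End PP.

Arguments pp_sol {R n} phi M.

(* Terms and formulas with free variables indexed by 'I_n; a quantifier binds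
   the variable 0 of its body, and shifts the other ones. The remaining
   connectives and the existential quantifier are classically definable. *)
Inductive term (R : Type) (n : nat) : Type :=
| TVar of 'I_n
| TZero
| TAdd of term R n & term R n
| TScale of R & term R n.

Inductive formula (R : Type) : nat -> Type :=
| FEq n of term R n & term R n : formula R n
| FFalse n : formula R n
| FImp n of formula R n & formula R n : formula R n
| FAll n of formula R n.+1 : formula R n.

Section FirstOrder.
Variable R : pzRingType.
Implicit Types M N : lmodType R.

Fixpoint eval M n (v : 'I_n -> M) (t : term R n) : M :=
  match t with
  | TVar i => v i
  | TZero => 0
  | TAdd t1 t2 => eval v t1 + eval v t2
  | TScale r t1 => r *: eval v t1
  end.

Definition ext_val M n (x : M) (v : 'I_n -> M) : 'I_n.+1 -> M :=
  fun i => oapp v x (unlift ord0 i).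

Fixpoint sat M n (phi : formula R n) : ('I_n -> M) -> Prop :=
  match phi with
  | FEq _ t1 t2 => fun v => eval v t1 = eval v t2
  | FFalse _ => fun=> False
  | FImp _ phi1 phi2 => fun v => sat phi1 v -> sat phi2 v
  | FAll _ phi1 => fun v => forall x, sat phi1 (ext_val x v)
  end.

Definition sentence := formula R 0.

Definition holds M (phi : sentence) := forall v : 'I_0 -> M, sat phi v.

Definition theory M : set sentence := [set phi | holds M phi].

Definition model (T : set sentence) M := forall phi, T phi -> holds M phi.

Definition elementary M N (f : M -> N) :=
  forall n (phi : formula R n) (v : 'I_n -> M), sat phi v <-> sat phi (f \o v).

Definition elementary_substructure N (S : submodClosed N) :=
  elementary (val : submod S -> N).

Definition T_aleph0 : set sentence := theory (free_aleph0 R).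

End FirstOrder.

Arguments T_aleph0 R : clear implicits.

(* In the conditions below K stands for a cardinal, and F for the module into
   which the K-generated modules embed. *)
Section Conditions.
Variable R : pzRingType.

Definition all_flat_ML := forall M : lmodType R, flat M -> mittag_leffler M.

Definition all_flat_models_ML :=
  forall M : lmodType R, flat M -> model (T_aleph0 R) M -> mittag_leffler M.

Variable K : Type.

Definition flat_projective :=
  forall M : lmodType R, card_generated K M -> flat M -> projective M.

Definition flat_models_projective :=
  forall M : lmodType R, card_generated K M -> flat M ->
    model (T_aleph0 R) M -> projective M.

Variable F : lmodType R.

Definition flat_summand :=
  forall M : lmodType R, card_generated K M -> flat M ->
    exists2 S : submodClosed F, direct_summand S & isomorphic M (submod S).

Definition flat_models_elementary_summand :=
  forall M : lmodType R, card_generated K M -> flat M ->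
    model (T_aleph0 R) M ->
    exists S : submodClosed F,
      [/\ direct_summand S, elementary_substructure S &
          isomorphic M (submod S)].

Definition flat_pure :=
  forall M : lmodType R, card_generated K M -> flat M ->
    exists f : {linear M -> F}, pure_mono f.

Definition flat_models_elementary :=
  forall M : lmodType R, card_generated K M -> flat M ->
    model (T_aleph0 R) M -> exists f : M -> F, elementary f.

Definition equivalences :=
  [<-> dcc_pp (@dvd_formulas R);
       all_flat_ML;
       all_flat_models_ML;
       flat_projective;
       flat_models_projective;
       flat_summand;
       flat_models_elementary_summand;
       flat_pure;
       flat_models_elementary;
       left_perfect R;
       dcc_principal_right_ideals R].

End Conditions.

(* Main.v *)
From HB Require Import structures.
Require Import Defs.
From Stdlib Require List.
From mathcomp Require Import all_boot all_algebra.
From mathcomp Require Import boolp classical_sets functions cardinality fsbigop.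

(** Three implications carry the proof. Let F0 be the free module of rank
    aleph0, and J the Jacobson radical of R.

    Every condition on flat modules or on flat models of the theory T of F0
    implies the descending chain condition on divisibility formulas A | x. A
    chain of such formulas gives matrices, hence endomorphisms of F0, and the
    direct limit B of F0 -> F0 -> ... along these is a countably generated flat
    module, as the one of Bass. If B is Mittag-Leffler then the chain stops
    ([dcc_pp_of_bass_models]). To have a model of T, B + F0 is used instead of
    B. Each condition makes B + F0 Mittag-Leffler, directly or because it gives
    the finite tuples in B + F0 the pp types of tuples in a projective module,
    and projective modules are Mittag-Leffler.

    The dcc on formulas A | x, for matrices A with one entry, is the dcc on
    principal right ideals.

    If R has the dcc on principal right ideals then flat modules are projective
    ([dcc_left_perfect]). A right ideal that is minimal among the principal
    ones outside J is generated by a local idempotent e. If M / N is flat and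
    nonzero then, by Nakayama's lemma, some x = e m, for one of these e, lies
    outside N + J M. Then R x is isomorphic to R e modulo N, and M / (N + R x)
    is flat again. So a lift of a linear map from M along an epimorphism
    extends from N to N + R x, and Zorn's lemma applies.

    Over a left perfect ring, all conditions are clear up to elementarity of
    the embeddings. For this, the elimination of quantifiers is proved for
    modules in which the pp-definable subgroups of one variable behave as in F0
    ([quantifier_elimination]). For these modules, the lemma of Neumann on
    coverings by cosets has a short proof, since an index is 1 or infinite
    ([avoid_cosets]). It follows that B + F0 and the sums of copies of F0 are
    models of T, and that an embedding between models of T which preserves pp
    types is elementary ([models_elementary]).

    Flatness is defined by tensor products, but it is used only through the
    equational criterion: a linear relation in M comes from relations in R
    ([eq_flat_flat], [flat_eq_flat]). *)

Set Implicit Arguments.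
Unset Strict Implicit.
Unset Printing Implicit Defensive.

Import GRing.Theory.
Local Open Scope classical_set_scope.
Local Open Scope ring_scope.

(** * Positive primitive formulas *)

Section PPFormulas.
Variable R : pzRingType.
Implicit Types (M N : lmodType R) (n : nat).

Lemma pp_solP M n (phi : pp R n) (x : 'I_n -> M) :
  pp_sol phi M x <-> exists y : 'I_(pp_bound phi) -> M,
    forall i, \sum_j pp_A phi i j *: y j = \sum_j pp_B phi i j *: x j.
Proof.
split=> -[y ey]; exists y.
  by move=> i; exact: (congr1 (fun h => h i) ey).
by apply/funext => i; exact: ey.
Qed.

Lemma pp_sol_linear M N (f : {linear M -> N}) n (phi : pp R n) (x : 'I_n -> M) :
  pp_sol phi M x -> pp_sol phi N (f \o x).
Proof.
move=> /pp_solP[y ey]; apply/pp_solP; exists (f \o y) => i.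
transitivity (f (\sum_j pp_A phi i j *: y j)).
  by rewrite linear_sum; apply: eq_bigr => j _; rewrite linearZ.
by rewrite ey linear_sum; apply: eq_bigr => j _; rewrite linearZ.
Qed.

Lemma pp_sol_retract M N (f : {linear M -> N}) (g : {linear N -> M}) n
    (phi : pp R n) (x : 'I_n -> M) :
  cancel f g -> pp_sol phi N (f \o x) <-> pp_sol phi M x.
Proof.
move=> fK; split=> [/(pp_sol_linear g)|]; last exact: pp_sol_linear.
by rewrite (_ : g \o (f \o x) = x) //; apply/funext => i /=; rewrite fK.
Qed.

Lemma pp_sol_sum M n (phi : pp R n) k (x : 'I_k -> 'I_n -> M) :
  (forall l, pp_sol phi M (x l)) -> pp_sol phi M (fun i => \sum_l x l i).
Proof.
move=> phix; have /choice[y ey] l := (pp_solP phi (x l)).1 (phix l).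
apply/pp_solP; exists (fun j => \sum_l y l j) => i.
transitivity (\sum_l \sum_j pp_A phi i j *: y l j).
  by rewrite exchange_big; apply: eq_bigr => j _; rewrite scaler_sumr.
under eq_bigr do rewrite ey.
by rewrite exchange_big; apply: eq_bigr => j _; rewrite scaler_sumr.
Qed.

Lemma pp_solD M n (phi : pp R n) (x y : 'I_n -> M) :
  pp_sol phi M x -> pp_sol phi M y -> pp_sol phi M (fun i => x i + y i).
Proof.
move=> phix phiy; pose z (l : 'I_2) := if l == ord0 then x else y.
have /(@pp_sol_sum _ _ phi 2 z) : forall l, pp_sol phi M (z l).
  by move=> l; rewrite /z; case: ifP.
congr (pp_sol phi M _); apply/funext => i.
by rewrite big_ord_recl big_ord1 /z /=.
Qed.

Lemma pp_solN M n (phi : pp R n) (x : 'I_n -> M) :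
  pp_sol phi M x -> pp_sol phi M (fun i => - x i).
Proof.
move=> phix; have oppl : linear (-%R : M -> M).
  by move=> a u v; rewrite opprD scalerN.
pose f := HB.pack_for {linear M -> M} (-%R : M -> M)
  (GRing.isLinear.Build R M M _ _ oppl).
exact: (pp_sol_linear f phix).
Qed.

Lemma pp_solB M n (phi : pp R n) (x y : 'I_n -> M) :
  pp_sol phi M x -> pp_sol phi M y -> pp_sol phi M (fun i => x i - y i).
Proof. by move=> phix phiy; apply/pp_solD/pp_solN. Qed.

Lemma pp_dvdP M n k (A : 'M[R]_(n, k)) (x : 'I_n -> M) :
  pp_sol (pp_dvd A) M x <->
  exists y : 'I_k -> M, forall i, x i = \sum_j A i j *: y j.
Proof.
have sum1 i : \sum_j (1%:M : 'M[R]_n) i j *: x j = x i.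
  rewrite (bigD1 i) //= mxE eqxx scale1r big1 ?addr0 // => j ji.
  by rewrite mxE eq_sym (negbTE ji) scale0r.
split=> [/pp_solP /= [y ey]|[y ey]].
  by exists y => i; rewrite ey sum1.
by apply/pp_solP; exists y => i /=; rewrite sum1.
Qed.

Definition pp_eq0 n (c : 'I_n -> R) : pp R n :=
  PP (0 : 'M[R]_(1, 0)) (\row_j c j).

Lemma pp_eq0P M n (c : 'I_n -> R) (x : 'I_n -> M) :
  pp_sol (pp_eq0 c) M x <-> \sum_j c j *: x j = 0.
Proof.
have e i : \sum_j (pp_B (pp_eq0 c)) i j *: x j = \sum_j c j *: x j.
  by apply: eq_bigr => j _; rewrite mxE.
split=> [/pp_solP[y] /(_ ord0)|sum0]; rewrite ?e ?big_ord0 //.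
by apply/pp_solP; exists (fun=> 0) => i; rewrite e big_ord0.
Qed.

Definition pp_true n : pp R n := pp_eq0 (fun=> 0).

Lemma pp_trueP M n (x : 'I_n -> M) : pp_sol (pp_true n) M x.
Proof. by apply/pp_eq0P; rewrite big1 // => j _; rewrite scale0r. Qed.

Definition pp_conj n (phi psi : pp R n) : pp R n :=
  PP (block_mx (pp_A phi) 0 0 (pp_A psi)) (col_mx (pp_B phi) (pp_B psi)).

Lemma pp_conjP M n (phi psi : pp R n) (x : 'I_n -> M) :
  pp_sol (pp_conj phi psi) M x <-> pp_sol phi M x /\ pp_sol psi M x.
Proof.
split=> [/pp_solP[y ey]|[/pp_solP[y ey] /pp_solP[z ez]]].
  split; apply/pp_solP.
    exists (fun j => y (lshift _ j)) => i; have /= := ey (lshift _ i).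
    rewrite big_split_ord /= [X in _ + X]big1 ?addr0 => [|j _]; last first.
      by rewrite block_mxEur mxE scale0r.
    under eq_bigr do rewrite block_mxEul.
    by move=> ->; apply: eq_bigr => j _; rewrite col_mxEu.
  exists (fun j => y (rshift _ j)) => i; have /= := ey (rshift _ i).
  rewrite big_split_ord /= [X in X + _]big1 ?add0r => [|j _]; last first.
    by rewrite block_mxEdl mxE scale0r.
  under eq_bigr do rewrite block_mxEdr.
  by move=> ->; apply: eq_bigr => j _; rewrite col_mxEd.
pose w (j : 'I_(pp_bound phi + pp_bound psi)) :=
  match fintype.split j with inl j1 => y j1 | inr j2 => z j2 end.
have wl j : w (lshift _ j) = y j by rewrite /w (unsplitK (inl j)).
have wr j : w (rshift _ j) = z j by rewrite /w (unsplitK (inr j)).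
apply/pp_solP; exists w => /= i; rewrite big_split_ord /=.
case: (split_ordP i) => {}i ->.
  rewrite [X in _ + X]big1 ?addr0 => [|j _]; last first.
    by rewrite block_mxEur mxE scale0r.
  under eq_bigr do rewrite block_mxEul wl.
  by rewrite ey; apply: eq_bigr => j _; rewrite col_mxEu.
rewrite [X in X + _]big1 ?add0r => [|j _]; last first.
  by rewrite block_mxEdl mxE scale0r.
under eq_bigr do rewrite block_mxEdr wr.
by rewrite ez; apply: eq_bigr => j _; rewrite col_mxEd.
Qed.

Lemma ext_val0 M n (x : M) (v : 'I_n -> M) : ext_val x v ord0 = x.
Proof. by rewrite /ext_val unlift_none. Qed.

Lemma ext_valS M n (x : M) (v : 'I_n -> M) i : ext_val x v (lift ord0 i) = v i.
Proof. by rewrite /ext_val liftK. Qed.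

Definition pp_ex n (phi : pp R n.+1) : pp R n :=
  PP (\matrix_(i, j) oapp (pp_A phi i) (- pp_B phi i ord0) (unlift ord0 j)
       : 'M_(pp_eqs phi, (pp_bound phi).+1))
     (\matrix_(i, j) pp_B phi i (lift ord0 j)).

Lemma pp_exP M n (phi : pp R n.+1) (v : 'I_n -> M) :
  pp_sol (pp_ex phi) M v <-> exists x, pp_sol phi M (ext_val x v).
Proof.
have eB x i : \sum_j pp_B phi i j *: ext_val x v j =
    pp_B phi i ord0 *: x + \sum_j pp_B (pp_ex phi) i j *: v j.
  rewrite big_ord_recl ext_val0; congr (_ + _); apply: eq_bigr => j _.
  by rewrite ext_valS mxE.
have eA (y : 'I_(pp_bound phi).+1 -> M) i : \sum_j pp_A (pp_ex phi) i j *: y j =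
    - (pp_B phi i ord0 *: y ord0) + \sum_j pp_A phi i j *: y (lift ord0 j).
  rewrite big_ord_recl mxE unlift_none /= scaleNr; congr (_ + _).
  by apply: eq_bigr => j _; rewrite mxE liftK.
split=> [/pp_solP[y ey]|[x /pp_solP[y ey]]].
  exists (y ord0); apply/pp_solP; exists (y \o lift ord0) => i.
  by rewrite eB -ey eA addNKr.
apply/pp_solP; exists (ext_val x y) => i; rewrite eA ext_val0.
by under eq_bigr do rewrite ext_valS; rewrite ey eB addKr.
Qed.

(** Two solutions of phi with the same parameters differ by a solution of this
    formula. *)
Definition pp_homog n (phi : pp R n.+1) : pp R 1 :=
  PP (pp_A phi) (\matrix_(i, j) pp_B phi i ord0).

Lemma pp_homogP M n (phi : pp R n.+1) (x : 'I_1 -> M) :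
  pp_sol (pp_homog phi) M x <-> pp_sol phi M (ext_val (x ord0) (fun=> 0)).
Proof.
have eB i : \sum_j pp_B phi i j *: ext_val (x ord0) (fun=> 0) j =
    \sum_j pp_B (pp_homog phi) i j *: x j.
  rewrite big_ord_recl ext_val0 big1 => [|j _]; last by rewrite ext_valS scaler0.
  by rewrite big_ord1 addr0 mxE.
by split=> /pp_solP[y ey]; apply/pp_solP; exists y => i; rewrite ey ?eB.
Qed.

Lemma pp_sol0 M (phi : pp R 0) (x : 'I_0 -> M) : pp_sol phi M x.
Proof.
apply/pp_solP; exists (fun=> 0) => i; rewrite big_ord0 big1 // => j _.
exact: scaler0.
Qed.

Definition elem1 M (x : M) : 'I_1 -> M := fun=> x.

End PPFormulas.

(** * Flatness and the equational criterion *)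

Lemma ord_cat T k1 k2 (f : 'I_k1 -> T) (g : 'I_k2 -> T) :
  exists h : 'I_(k1 + k2) -> T,
    (forall l, h (lshift k2 l) = f l) /\ (forall l, h (rshift k1 l) = g l).
Proof.
exists (fun l => match fintype.split l with inl i => f i | inr j => g j end).
by split=> l; rewrite ?(unsplitK (inl l)) ?(unsplitK (inr l)).
Qed.

Section EquationalCriterion.
Variable R : pzRingType.

(** Flatness of M / N without the quotient module: a linear relation that
    holds modulo N comes from relations that hold in R. *)
Definition eq_criterion (M : lmodType R) (N : set M) :=
  forall n (c : 'I_n -> R) (m : 'I_n -> M), N (\sum_i c i *: m i) ->
  exists k (D : 'I_n -> 'I_k -> R) (w : 'I_k -> M),
    (forall i, N (m i - \sum_l D i l *: w l)) /\
    (forall l, \sum_i c i * D i l = 0).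

Definition eq_flat (M : lmodType R) := @eq_criterion M [set 0].

Lemma eq_flatP (M : lmodType R) :
  eq_flat M <->
  (forall n (c : 'I_n -> R) (m : 'I_n -> M), \sum_i c i *: m i = 0 ->
   exists k (D : 'I_n -> 'I_k -> R) (w : 'I_k -> M),
    (forall i, m i = \sum_l D i l *: w l) /\
    (forall l, \sum_i c i * D i l = 0)).
Proof.
split=> flatM n c m /(flatM n c m)[k [D [w [mE cD]]]]; exists k, D, w; split=> // i.
  exact/subr0_eq/mE.
by rewrite /= mE subrr.
Qed.

Lemma sum_scale_sum (M : lmodType R) n k (c : 'I_n -> R) (D : 'I_n -> 'I_k -> R)
    (w : 'I_k -> M) :
  \sum_i c i *: (\sum_l D i l *: w l) = \sum_l (\sum_i c i * D i l) *: w l.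
Proof.
under eq_bigr do rewrite scaler_sumr.
rewrite exchange_big; apply: eq_bigr => l _; rewrite scaler_suml.
by apply: eq_bigr => i _; rewrite scalerA.
Qed.

Lemma sum_delta (M : lmodType R) k (w : 'I_k -> M) l :
  \sum_j (j == l)%:R *: w j = w l.
Proof.
rewrite (bigD1 l) //= eqxx scale1r big1 ?addr0 // => j /negbTE->.
exact: scale0r.
Qed.

(** A system of equations reduces to a single one by treating its rows in
    turn: the generators w that solve the first rows are refined by those
    that solve the next row. *)
Lemma eq_flat_system (M : lmodType R) n p (C : 'I_p -> 'I_n -> R) (m : 'I_n -> M) :
  eq_flat M -> (forall q, \sum_i C q i *: m i = 0) ->
  exists k (D : 'I_n -> 'I_k -> R) (w : 'I_k -> M),
    (forall i, m i = \sum_l D i l *: w l) /\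
    (forall q l, \sum_i C q i * D i l = 0).
Proof.
move=> /eq_flatP flatM; elim: p C => [|p IHp] C Cm.
  exists n, (fun i l => (l == i)%:R), m; split=> [i|[]//].
  by rewrite sum_delta.
have [k [D [w [mE CD]]]] := IHp (C \o lift ord0) (fun q => Cm (lift ord0 q)).
have /flatM[k' [D' [w' [wE CD']]]] : \sum_l (\sum_i C ord0 i * D i l) *: w l = 0.
  by rewrite -sum_scale_sum -[RHS](Cm ord0); under eq_bigr do rewrite -mE.
exists k', (fun i l => \sum_j D i j * D' j l), w'; split=> [i|q l].
  by rewrite mE -sum_scale_sum; under eq_bigr do rewrite wE.
under eq_bigr do rewrite mulr_sumr; rewrite exchange_big /=.
under eq_bigr do (under eq_bigr do rewrite mulrA; rewrite -mulr_suml).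
have [q'|] := unliftP ord0 q; last by move->.
by move=> ->; rewrite big1 // => j _; rewrite (CD q') mul0r.
Qed.

Section Tensor.
Variables (A : lmodType R^c) (M : lmodType R).
Implicit Types (s t : seq (A * M)).

(** The list s stands for the sum of the w l (x) z l, because each right factor
    of s is expanded as a combination of the z l. *)
Fixpoint expands k (z : 'I_k -> M) s (w : 'I_k -> A) : Prop :=
  if s is (a, m) :: s' then
    exists (c : 'I_k -> R) (w' : 'I_k -> A),
      [/\ m = \sum_l c l *: z l, expands z s' w' &
          forall l, w l = w' l + (c l : R^c) *: a]
  else forall l, w l = 0.

Lemma expands_refine k j (z : 'I_k -> M) (z' : 'I_j -> M) (D : 'I_k -> 'I_j -> R)
    s w :
  (forall l, z l = \sum_i D l i *: z' i) -> expands z s w ->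
  expands z' s (fun i => \sum_l (D l i : R^c) *: w l).
Proof.
move=> zE; elim: s w => [|[a m] s IHs] w /=.
  by move=> w0 i; rewrite big1 // => l _; rewrite w0 scaler0.
move=> [c [w' [mE sw' wE]]].
exists (fun i => \sum_l c l * D l i), (fun i => \sum_l (D l i : R^c) *: w' l).
split=> [||i]; first by rewrite mE -sum_scale_sum; under eq_bigr do rewrite zE.
  exact: IHs.
rewrite scaler_suml -big_split; apply: eq_bigr => l _.
by rewrite wE scalerDr scalerA.
Qed.

Lemma expands_ext k (z : 'I_k -> M) s w w' :
  w =1 w' -> expands z s w -> expands z s w'.
Proof. by move=> /funext->. Qed.

Lemma expands_cat k (z : 'I_k -> M) s t w w' :
  expands z s w -> expands z t w' ->
  expands z (s ++ t) (fun l => w l + w' l).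
Proof.
move=> + tw'; elim: s w => [|[a m] s IHs] w /=.
  by move=> w0; apply: expands_ext tw' => l; rewrite w0 add0r.
move=> [c [w1 [mE /IHs sw1 wE]]]; exists c, (fun l => w1 l + w' l); split=> // l.
by rewrite wE addrAC.
Qed.

Lemma common_refinement k j (z : 'I_k -> M) (z' : 'I_j -> M) :
  exists (D : 'I_k -> 'I_(k + j) -> R) (D' : 'I_j -> 'I_(k + j) -> R) y,
    (forall l, z l = \sum_i D l i *: y i) /\
    (forall l, z' l = \sum_i D' l i *: y i).
Proof.
have [y [yl yr]] := ord_cat z z'.
exists (fun l i => (i == lshift j l)%:R), (fun l i => (i == rshift k l)%:R), y.
by split=> l; rewrite sum_delta ?yl ?yr.
Qed.

Lemma expands_total s : exists k (z : 'I_k -> M) w, expands z s w.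
Proof.
elim: s => [|[a m] s [k [z [w sw]]]]; first by exists 0%N, (fun=> 0), (fun=> 0).
have [D [D' [y [zE mE]]]] := common_refinement z (fun _ : 'I_1 => m).
have sy := expands_refine zE sw.
by exists (k + 1)%N, y; eexists => /=; exists (D' ord0); eexists; split;
  [exact: (mE ord0) | exact: sy | by []].
Qed.

(** Two expansions of one list have a common refinement on which their left
    factors agree: the two expressions of a right factor give a relation
    between the z l and the z' l, which flatness trivializes. *)
Lemma expands_agree s k j (z : 'I_k -> M) (z' : 'I_j -> M) w w' :
  eq_flat M -> expands z s w -> expands z' s w' ->
  exists i (D : 'I_k -> 'I_i -> R) (D' : 'I_j -> 'I_i -> R) y,
    [/\ forall l, z l = \sum_h D l h *: y h,
        forall l, z' l = \sum_h D' l h *: y h &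
        forall h, \sum_l (D l h : R^c) *: w l = \sum_l (D' l h : R^c) *: w' l].
Proof.
move=> /eq_flatP flatM; elim: s w w' => [|[a m] s IHs] w w' /=.
  move=> w0 w'0; have [D [D' [y [zE z'E]]]] := common_refinement z z'.
  exists (k + j)%N, D, D', y; split=> // h.
  by rewrite !big1 // => l _; rewrite ?w0 ?w'0 scaler0.
move=> [c [v [mE sv wE]]] [c' [v' [mE' sv' wE']]].
have [i [D [D' [y [zE zE' vv']]]]] := IHs _ _ sv sv'.
have : \sum_h (\sum_l c l * D l h - \sum_l c' l * D' l h) *: y h = 0.
  under eq_bigr do rewrite scalerBl.
  rewrite sumrB -!sum_scale_sum; under eq_bigr do rewrite -zE.
  rewrite -mE; under eq_bigr do rewrite -zE'.
  by rewrite -mE' subrr.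
move=> /flatM[p [E [x [yE cE]]]].
exists p, (fun l q => \sum_h D l h * E h q), (fun l q => \sum_h D' l h * E h q), x.
have refine (T : finType) (B : T -> 'I_i -> R) (d u : T -> A) q :
    \sum_l ((\sum_h B l h * E h q) : R^c) *: (u l + d l) =
    \sum_h (E h q : R^c) *: (\sum_l (B l h : R^c) *: u l) +
    \sum_l ((\sum_h B l h * E h q) : R^c) *: d l.
  under eq_bigr do rewrite scalerDr; rewrite big_split; congr (_ + _).
  under [RHS]eq_bigr do rewrite scaler_sumr.
  rewrite [RHS]exchange_big; apply: eq_bigr => l _; rewrite scaler_suml.
  by apply: eq_bigr => h _; rewrite scalerA.
have coeff (T : finType) (B : T -> 'I_i -> R) (b : T -> R) q :
    \sum_l ((\sum_h B l h * E h q) : R^c) *: ((b l : R^c) *: a) =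
    ((\sum_h (\sum_l b l * B l h) * E h q) : R^c) *: a.
  under eq_bigr do rewrite scalerA; rewrite -scaler_suml; congr (_ *: a).
  under [RHS]eq_bigr do rewrite mulr_suml; rewrite exchange_big /=.
  apply: eq_bigr => l _; rewrite [LHS]mulr_sumr.
  by apply: eq_bigr => h _; rewrite -mulrA.
split=> [l|l|q].
- by rewrite zE -sum_scale_sum; under eq_bigr do rewrite yE.
- by rewrite zE' -sum_scale_sum; under eq_bigr do rewrite yE.
under eq_bigr do rewrite wE; under [RHS]eq_bigr do rewrite wE'.
rewrite !refine !coeff; congr (_ + _).
  by apply: eq_bigr => h _; rewrite vv'.
congr (_ *: a); apply/subr0_eq; rewrite -[RHS](cE q) -sumrB.
by apply: eq_bigr => h _; rewrite mulrBl.
Qed.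

(** Among the rules that generate the congruence, transitivity is the only one
    that needs flatness, in the form of [expands_agree]. *)
Lemma tensor_eq_expands s t : eq_flat M -> tensor_eq s t ->
  exists k (z : 'I_k -> M) w, expands z s w /\ expands z t w.
Proof.
move=> flatM; elim=> {s t}
  [s|s t _|s t u _ + _|s s' t t' _ + _|s t|m|a b m|a m n|a r m].
- by have [k [z [w sw]]] := expands_total s; exists k, z, w.
- by move=> [k [z [w [sw tw]]]]; exists k, z, w.
- move=> [k [z [w [sw tw]]]] [k' [z' [w' [tw' uw']]]].
  have [i [D [D' [y [zE zE' ww']]]]] := expands_agree flatM tw tw'.
  exists i, y, (fun h => \sum_l (D l h : R^c) *: w l); split.
    exact: expands_refine sw.
  apply: (expands_ext (fun h => esym (ww' h))).
  exact: expands_refine uw'.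
- move=> [k [z [w [sw sw']]]] [k' [z' [w' [tw tw']]]].
  have [D [D' [y [zE zE']]]] := common_refinement z z'.
  exists (k + k')%N, y; eexists; split; apply: expands_cat.
  + exact: expands_refine zE sw.
  + exact: expands_refine zE' tw.
  + exact: expands_refine zE sw'.
  + exact: expands_refine zE' tw'.
- have [k [z [w sw]]] := expands_total s.
  have [k' [z' [w' tw']]] := expands_total t.
  have [D [D' [y [zE zE']]]] := common_refinement z z'.
  have sy := expands_refine zE sw; have ty := expands_refine zE' tw'.
  exists (k + k')%N, y; eexists; split; first exact: expands_cat sy ty.
  by apply: expands_ext (expands_cat ty sy) => l; rewrite addrC.
- exists 1%N, (fun=> m), (fun=> 0); split=> //=.
  exists (fun=> 1), (fun=> 0); split=> // [|_].
    by rewrite big_ord1 scale1r.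
  by rewrite scaler0 addr0.
- exists 1%N, (fun=> m), (fun=> a + b); split=> /=.
    exists (fun=> 1), (fun=> 0); split=> // [|_]; rewrite ?big_ord1 ?scale1r //.
    by rewrite add0r.
  exists (fun=> 1), (fun=> b); split=> [||_]; rewrite ?big_ord1 ?scale1r //.
    exists (fun=> 1), (fun=> 0); split=> // [|_]; rewrite ?big_ord1 ?scale1r //.
    by rewrite add0r.
  by rewrite addrC.
- pose z (l : 'I_2) := if l == ord0 then m else n.
  have zE (c : 'I_2 -> R) : \sum_l c l *: z l = c ord0 *: m + c (lift ord0 ord0) *: n.
    by rewrite big_ord_recl big_ord1.
  exists 2, z, (fun=> a); split=> /=.
    exists (fun=> 1), (fun=> 0); split=> // [|_]; rewrite ?zE ?scale1r //.
    by rewrite add0r.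
  exists (fun l => (l == ord0)%:R), (fun l => ((l != ord0)%:R : R^c) *: a).
  split=> [||l].
  - by rewrite zE scale1r scale0r addr0.
  - exists (fun l => (l != ord0)%:R), (fun=> 0); split=> // [|l].
      by rewrite zE scale1r scale0r add0r.
    by rewrite add0r.
  by case: (l == ord0); rewrite scale0r scale1r ?addr0 ?add0r.
- exists 1%N, (fun=> m), (fun=> (r : R^c) *: a); split=> /=.
    exists (fun=> 1), (fun=> 0); split=> // [|_]; rewrite ?big_ord1 ?scale1r //.
    by rewrite add0r.
  exists (fun=> r), (fun=> 0); split=> // [|_]; rewrite ?big_ord1 //.
  by rewrite add0r.
Qed.

End Tensor.

Lemma expands_linear_inj (A B : lmodType R^c) (f : {linear A -> B})
    (M : lmodType R) k (z : 'I_k -> M) s w :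
  expands z [seq (f p.1, p.2) | p <- s] w ->
  exists2 v, w =1 f \o v & expands z s v.
Proof.
elim: s w => [|[a m] s IHs] w /=.
  by move=> w0; exists (fun=> 0) => // l; rewrite /= w0 linear0.
move=> [c [w' [mE /IHs[v wE' sv] wE]]].
exists (fun l => v l + (c l : R^c) *: a); last by exists c, v.
by move=> l /=; rewrite wE wE' linearD linearZ.
Qed.

Section TensorSums.
Variables (A : lmodType R^c) (M : lmodType R).
Implicit Types (a b : A) (m n : M) (s t : seq (A * M)).

Lemma tensor_0r a : tensor_eq [:: (a, 0 : M)] [::].
Proof.
have := tensor_Z a 0 (0 : M); rewrite scaler0 => h.
by apply: tensor_trans (tensor_sym h) _; rewrite scale0r; exact: tensor_0l.
Qed.

Lemma tensor_cons (p : A * M) s t : tensor_eq s t -> tensor_eq (p :: s) (p :: t).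
Proof. by move=> st; exact: (tensor_cat (tensor_refl [:: p]) st). Qed.

Lemma tensor_cat0 s t : tensor_eq s [::] -> tensor_eq t [::] ->
  tensor_eq (s ++ t) [::].
Proof. by move=> s0 t0; exact: (tensor_cat s0 t0). Qed.

Lemma tensor_sum (I : Type) (r : seq I) a (m : I -> M) :
  tensor_eq [:: (a, \sum_(i <- r) m i)] [seq (a, m i) | i <- r].
Proof.
elim: r => [|i r IHr]; first by rewrite big_nil; exact: tensor_0r.
rewrite big_cons; apply: tensor_trans (tensor_Dr _ _ _) _.
exact: tensor_cons.
Qed.

Lemma tensor_zip (I : Type) (r : seq I) (a b : I -> A) (m : I -> M) :
  tensor_eq ([seq (a i, m i) | i <- r] ++ [seq (b i, m i) | i <- r])
            [seq (a i + b i, m i) | i <- r].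
Proof.
elim: r => [|i r IHr] /=; first exact: tensor_refl.
set s := map _ _ in IHr *; set t := map _ _ in IHr *.
apply: (@tensor_trans _ _ _ _ ([:: (a i, m i); (b i, m i)] ++ (s ++ t))).
  apply: tensor_cons; rewrite -[_ :: t]cat1s catA.
  exact: (tensor_cat (tensor_comm s [:: (b i, m i)]) (tensor_refl t)).
exact: (tensor_cat (tensor_sym (tensor_Dl _ _ _)) IHr).
Qed.

Lemma expands_tensor k (z : 'I_k -> M) s w : expands z s w ->
  tensor_eq s [seq (w l, z l) | l <- enum 'I_k].
Proof.
elim: s w => [|[a m] s IHs] w /=.
  move=> w0; apply: tensor_sym; elim: (enum _) => [|l r IHr] /=.
    exact: tensor_refl.
  rewrite w0; exact: (tensor_cat0 (tensor_0l _ _) IHr).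
move=> [c [w' [-> /IHs sw' wE]]].
have -> : [seq (w l, z l) | l <- enum 'I_k] =
          [seq ((c l : R^c) *: a + w' l, z l) | l <- enum 'I_k].
  by apply: eq_map => l; rewrite wE addrC.
apply: tensor_trans (tensor_zip _ _ _ _).
rewrite -cat1s; apply: (tensor_cat _ sw').
rewrite -big_enum; apply: tensor_trans (tensor_sum _ _ _) _ => /=.
elim: (enum _) => [|l r IHr] /=; first exact: tensor_refl.
exact: (tensor_cat (tensor_sym (tensor_Z _ _ _)) IHr).
Qed.

End TensorSums.

Lemma eq_flat_flat (M : lmodType R) : eq_flat M -> flat M.
Proof.
move=> flatM A B f finj x y.
rewrite -[x]reprK -[y]reprK -!/(tensor_class _) !tensor_map_class.
move/tensor_classP/(tensor_eq_expands flatM) => [k [z [w [sw tw]]]].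
have [v wE sv] := expands_linear_inj sw.
have [v' wE' tv] := expands_linear_inj tw.
apply/tensor_classP; apply: tensor_trans (expands_tensor sv) _.
rewrite (_ : v = v'); first exact/tensor_sym/expands_tensor.
by apply/funext => l; apply: finj; rewrite -[LHS]wE -[RHS]wE'.
Qed.

End EquationalCriterion.

Section RightIdeal.
Variables (R : pzRingType) (n : nat) (c : 'I_n -> R).

Definition right_ideal : {pred (R^c)^o} :=
  fun x => `[< exists d : 'I_n -> R, x = \sum_i c i * d i >].

Lemma right_ideal_submod : submod_closed right_ideal.
Proof.
split=> [|a x y /asboolP[d ->] /asboolP[e ->]]; apply/asboolP.
  by exists (fun=> 0); rewrite big1 // => i _; rewrite mulr0.
exists (fun i => d i * a + e i); rewrite [a *: _]mulr_suml -big_split.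
by apply: eq_bigr => i _; rewrite mulrDr mulrA.
Qed.

HB.instance Definition _ := GRing.isSubmodClosed.Build R^c (R^c)^o right_ideal
  right_ideal_submod.

Lemma right_ideal_gen i : c i \in right_ideal.
Proof.
apply/asboolP; exists (fun j => (j == i)%:R).
by rewrite (bigD1 i) //= eqxx mulr1 big1 ?addr0 // => j /negbTE->; rewrite mulr0.
Qed.

Definition right_ideal_elt i : submod right_ideal :=
  exist _ (c i : (R^c)^o) (right_ideal_gen i).

Definition right_ideal_incl : {linear submod right_ideal -> (R^c)^o} := val.

Variable M : lmodType R.
Implicit Types (s t : seq (submod right_ideal * M)) (u : 'I_n -> M).

(** For the right ideal I that the c i generate, these relations form the kernel
    of the map M^n -> I (x) M. *)
Definition trivial_relation u := exists k (D : 'I_n -> 'I_k -> R) (w : 'I_k -> M),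
  (forall i, u i = \sum_l D i l *: w l) /\ (forall l, \sum_i c i * D i l = 0).

Lemma trivial_relation_scale (d : 'I_n -> R) (m : M) :
  \sum_i c i * d i = 0 -> trivial_relation (fun i => d i *: m).
Proof.
by move=> cd; exists 1%N, (fun i _ => d i), (fun=> m); split=> // i; rewrite big_ord1.
Qed.

Lemma trivial_relationD u u' :
  trivial_relation u -> trivial_relation u' -> trivial_relation (fun i => u i + u' i).
Proof.
move=> [k [D [w [uE cD]]]] [k' [D' [w' [uE' cD']]]].
have [y [yl yr]] := ord_cat w w'.
have /choice[E /all_and2[El Er]] i := ord_cat (D i) (D' i).
exists (k + k')%N, E, y; split=> [i|l].
  rewrite big_split_ord uE uE' /=; congr (_ + _);
    by apply: eq_bigr => l _; rewrite ?(El, Er) ?(yl, yr).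
by case: (split_ordP l) => {}l ->; under eq_bigr do rewrite ?(El, Er).
Qed.

Lemma trivial_relationN u :
  trivial_relation u -> trivial_relation (fun i => - u i).
Proof.
move=> [k [D [w [uE cD]]]]; exists k, (fun i l => - D i l), w; split=> [i|l].
  by rewrite uE -sumrN; apply: eq_bigr => l _; rewrite scaleNr.
by under eq_bigr do rewrite mulrN; rewrite sumrN cD oppr0.
Qed.

(** A preimage of s under M^n -> I (x) M, where I is the right ideal. *)
Fixpoint lifts s u : Prop :=
  if s is (a, m) :: s' then
    exists (d : 'I_n -> R) u', [/\ (val a : R) = \sum_i c i * d i, lifts s' u' &
      forall i, u i = u' i + d i *: m]
  else forall i, u i = 0.

Lemma lifts_ext s u u' : u =1 u' -> lifts s u -> lifts s u'.
Proof. by move=> /funext->. Qed.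

Lemma lifts_total s : exists u, lifts s u.
Proof.
elim: s => [|[a m] s [u su]]; first by exists (fun=> 0).
have /asboolP[d aE] := valP a.
by exists (fun i => u i + d i *: m), d, u.
Qed.

Lemma lifts_unique s u u' : lifts s u -> lifts s u' ->
  trivial_relation (fun i => u i - u' i).
Proof.
elim: s u u' => [|[a m] s IHs] u u' /=.
  move=> u0 u'0; exists 0%N, (fun _ _ => 0), (fun=> 0); split=> [i|[]//].
  by rewrite big_ord0 u0 u'0 subrr.
move=> [d [v [aE sv uE]]] [d' [v' [aE' sv' uE']]].
have cdd' : \sum_i c i * (d i - d' i) = 0.
  by under eq_bigr do rewrite mulrBr; rewrite sumrB -aE -aE' subrr.
rewrite (_ : (fun i => _) = fun i => (v i - v' i) + (d i - d' i) *: m).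
  exact: trivial_relationD (IHs _ _ sv sv') (trivial_relation_scale m cdd').
by apply/funext => i; rewrite uE uE' scalerBl opprD addrACA.
Qed.

Lemma lifts_cat s t u u' : lifts s u -> lifts t u' ->
  lifts (s ++ t) (fun i => u i + u' i).
Proof.
move=> + tu; elim: s u => [|[a m] s IHs] u /=.
  by move=> u0; apply: lifts_ext tu => i; rewrite u0 add0r.
move=> [d [v [aE /IHs sv uE]]]; exists d, (fun i => v i + u' i).
by split=> // i; rewrite uE addrAC.
Qed.

Lemma lifts_tensor_eq s t : tensor_eq s t -> forall u u', lifts s u -> lifts t u' ->
  trivial_relation (fun i => u i - u' i).
Proof.
pose good s t := forall u u', lifts s u -> lifts t u' ->
  trivial_relation (fun i => u i - u' i).
have good_trans s1 s2 s3 : good s1 s2 -> good s2 s3 -> good s1 s3.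
  move=> s12 s23 u u' su tu; have [v sv] := lifts_total s2.
  have := trivial_relationD (s12 _ _ su sv) (s23 _ _ sv tu).
  by congr trivial_relation; apply/funext => i; rewrite addrA addrNK.
have good_sym s1 s2 : good s1 s2 -> good s2 s1.
  move=> s12 u u' su tu; have := trivial_relationN (s12 _ _ tu su).
  by congr trivial_relation; apply/funext => i; rewrite opprB.
have good_sub s1 s2 : (forall u, lifts s1 u -> lifts s2 u) -> good s1 s2.
  by move=> s12 u u' /s12; exact: lifts_unique.
rewrite -/(good s t); elim=> {s t}
  [s|s t _|s t u _ + _|s s' t t' _ + _|s t|m|a b m|a m p|a r m].
- exact: good_sub.
- exact: good_sym.
- exact: good_trans.
- move=> ss' tt' u u' su tu; have [v sv] := lifts_total s.
  have [v' sv'] := lifts_total s'; have [w tw] := lifts_total t.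
  have [w' tw'] := lifts_total t'.
  have := trivial_relationD (lifts_unique su (lifts_cat sv tw))
            (lifts_unique (lifts_cat sv' tw') tu).
  move=> /(trivial_relationD (trivial_relationD (ss' _ _ sv sv') (tt' _ _ tw tw'))).
  congr trivial_relation; apply/funext => i.
  rewrite [X in X + _]addrACA -opprD addrA [X in X + _]addrC addrA addrNK.
  by rewrite addrA addrNK.
- move=> u u' su tu; have [v sv] := lifts_total s; have [w tw] := lifts_total t.
  have := trivial_relationD (lifts_unique su (lifts_cat sv tw))
            (lifts_unique (lifts_cat tw sv) tu).
  congr trivial_relation; apply/funext => i.
  by rewrite [w i + _]addrC addrA addrNK.
- apply/good_sym/good_sub => u /= u0; exists (fun=> 0), u; split=> // [|i].
    by rewrite big1 // => i _; rewrite mulr0.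
  by rewrite scale0r addr0.
- apply/good_sym/good_sub => u /= [d [v [aE [d' [v' [bE v'0 vE]]] uE]]].
  exists (fun i => d i + d' i), v'; split=> // [|i].
    transitivity (\sum_i c i * d i + \sum_i c i * d' i); first by rewrite -aE -bE.
    by rewrite -big_split; apply: eq_bigr => i _; rewrite mulrDr.
  by rewrite uE vE v'0 !add0r scalerDl addrC.
- apply/good_sub => u /= [d [v [aE v0 uE]]].
  exists d, (fun i => d i *: p); split=> // [|i]; last first.
    by rewrite uE v0 add0r scalerDr addrC.
  by exists d, v; split=> // i; rewrite v0 add0r.
- apply/good_sym/good_sub => u /= [d [v [aE v0 uE]]].
  exists (fun i => d i * r), v; split=> // [|i]; last by rewrite uE scalerA.
  transitivity ((\sum_i c i * d i) * r); first by rewrite -aE.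
  by rewrite mulr_suml; apply: eq_bigr => i _; rewrite mulrA.
Qed.

End RightIdeal.

(** The relation c . m = 0 says that the tensor of the c i and the m i vanishes
    in R (x) M. By flatness it vanishes in I (x) M, where I is the right ideal
    that is generated by the c i, and I (x) M is the quotient of M^n by the
    trivial relations. *)
Lemma flat_eq_flat (R : pzRingType) (M : lmodType R) : flat M -> eq_flat M.
Proof.
move=> flatM; apply/eq_flatP => n c m cm.
pose g := @right_ideal_elt R n c.
pose s := [seq (g i, m i) | i <- enum 'I_n].
have s0 : tensor_eq s [::].
  apply/tensor_classP.
  have incl_inj : injective (right_ideal_incl c) := val_inj.
  apply: (flatM _ _ _ incl_inj).
  rewrite !tensor_map_class; apply/tensor_classP => /=.
  have h : tensor_eq [seq (1 : (R^c)^o, c i *: m i) | i <- enum 'I_n] [::].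
    apply: tensor_trans (tensor_sym (tensor_sum _ _ _)) _.
    by rewrite big_enum cm; exact: tensor_0r.
  apply: tensor_trans h; rewrite /s -map_comp.
  elim: (enum _) => [|i r IHr] /=; first exact: tensor_refl.
  have := tensor_Z (1 : (R^c)^o) (c i) (m i).
  rewrite (_ : _ *: _ = c i :> (R^c)^o) => [ci|]; last exact: (@mulr1 R^c).
  exact: (tensor_cat ci IHr).
have sm : lifts s m.
  have gen (r : seq 'I_n) : lifts [seq (g i, m i) | i <- r]
      (fun i => \sum_(j <- r) (i == j)%:R *: m j).
    elim: r => [|j r IHr] /=; first by move=> i; rewrite big_nil.
    exists (fun i => (i == j)%:R); eexists; split; [|exact: IHr|].
      rewrite (bigD1 j) //= eqxx mulr1 big1 ?addr0 // => i /negbTE->.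
      by rewrite mulr0.
    by move=> i; rewrite big_cons addrC.
  apply: lifts_ext (gen _) => i; rewrite big_enum /= -[RHS](sum_delta m).
  by apply: eq_bigr => j _; rewrite eq_sym.
have [k [D [w [mE cD]]]] := lifts_tensor_eq s0 sm (fun i => erefl (0 : M)).
by exists k, D, w; split=> // i; rewrite -mE subr0.
Qed.

(** * Direct sums, projective and Mittag-Leffler modules *)

Section DirectSums.
Variables (R : pzRingType) (I : Type) (M : lmodType R).
Implicit Types (i j : {classic I}) (m : M) (x : dsum I M).

Lemma dsum_support n (x : 'I_n -> dsum I M) : exists2 r : seq {classic I},
  uniq r & forall l i, i \notin r -> val (x l) i = 0.
Proof.
have supp l : exists r : seq {classic I}, forall i, i \notin r -> val (x l) i = 0.
  have /asboolP/(@finite_seqP {classic I})[r rE] := valP (x l).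
  exists r => i; apply: contraNeq => xi.
  by have : [set` r] i by rewrite -rE.
have {supp}/choice[r rP] := supp.
exists (undup (flatten [seq r l | l <- enum 'I_n])); first exact: undup_uniq.
move=> l i; rewrite mem_undup => ir; apply: rP; apply: contra ir => ir.
by apply/flatten_mapP; exists l; rewrite ?mem_enum.
Qed.

Definition dcoord i x : M := val x i.

Lemma dcoord_linear i : linear (dcoord i).
Proof. by []. Qed.

HB.instance Definition _ i :=
  GRing.isLinear.Build R (dsum I M) M _ (dcoord i) (dcoord_linear i).

Lemma dinj_finsupp i m : finsupp (fun j : {classic I} => if j == i then m else 0).
Proof.
apply/asboolP; apply: (@sub_finite_set _ _ [set i]) (finite_set1 i) => j /=.
by case: (j =P i) => // _; rewrite eqxx.
Qed.

Definition dinj i m : dsum I M :=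
  exist (fun f : I -> M => finsupp f) _ (dinj_finsupp i m).

Lemma dinj_linear i : linear (dinj i).
Proof.
move=> a m m'; apply/val_inj/funext => j0; pose j : {classic I} := j0.
suff : (if j == i then a *: m + m' else 0) =
       a *: (if j == i then m else 0) + (if j == i then m' else 0) by [].
by case: ifP => // _; rewrite scaler0 addr0.
Qed.

HB.instance Definition _ i :=
  GRing.isLinear.Build R M (dsum I M) _ (dinj i) (dinj_linear i).

Lemma dcoord_dinj i j m : dcoord j (dinj i m) = if j == i then m else 0.
Proof. by []. Qed.

Lemma dcoord_inj x y : (forall i, dcoord i x = dcoord i y) -> x = y.
Proof. by move=> xy; apply/val_inj/funext => i; exact: xy. Qed.

Variables (N : lmodType R) (g : {classic I} -> {linear M -> N}).

Definition dsum_lift x : N := \sum_(i \in [set: {classic I}]) g i (dcoord i x).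

Lemma dsum_liftE (r : seq {classic I}) x : uniq r ->
  (forall i, i \notin r -> dcoord i x = 0) ->
  dsum_lift x = \sum_(i <- r) g i (dcoord i x).
Proof.
move=> ur r0; rewrite /dsum_lift (fsbigE r) //; last first.
  by move=> i _ /r0->; rewrite linear0.
by under eq_bigl do rewrite in_setT.
Qed.

Lemma dsum_lift_linear : linear dsum_lift.
Proof.
move=> a x y.
have [r ur r0] := dsum_support (fun l : 'I_2 => if l == ord0 then x else y).
have rx i : i \notin r -> dcoord i x = 0 := r0 ord0 i.
have ry i : i \notin r -> dcoord i y = 0 := r0 (lift ord0 ord0) i.
rewrite !(dsum_liftE ur) // => [|i ir].
  rewrite scaler_sumr -big_split; apply: eq_bigr => i _ /=.
  by rewrite !linearP.
by rewrite dcoord_linear rx // ry // scaler0 addr0.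
Qed.

HB.instance Definition _ :=
  GRing.isLinear.Build R (dsum I M) N _ dsum_lift dsum_lift_linear.

Lemma dsum_lift_dinj i m : dsum_lift (dinj i m) = g i m.
Proof.
rewrite (@dsum_liftE [:: i]) ?big_seq1 ?dcoord_dinj ?eqxx // => j.
by rewrite inE dcoord_dinj => /negbTE->.
Qed.

Lemma dsum_decomp (r : seq {classic I}) x : uniq r ->
  (forall i, i \notin r -> dcoord i x = 0) -> x = \sum_(i <- r) dinj i (dcoord i x).
Proof.
move=> ur r0; apply: dcoord_inj => i; rewrite linear_sum /=.
have [ir|/[dup] ir /r0->] := boolP (i \in r).
  rewrite (bigD1_seq i) //= dcoord_dinj eqxx big1 ?addr0 // => j.
  by rewrite dcoord_dinj eq_sym => /negbTE->.
rewrite big1_seq // => j /andP[_ jr]; rewrite dcoord_dinj.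
by case: eqP ir => // ->; rewrite jr.
Qed.

End DirectSums.

Section Projective.
Variable R : pzRingType.
Implicit Types M N P : lmodType R.

Section ScalarMap.
Variables (M : lmodType R) (m : M).

Definition scalar_map : R^o -> M := fun r : R => r *: m.

Lemma scalar_map_linear : linear scalar_map.
Proof. by move=> a r s; rewrite /scalar_map scalerDl scalerA. Qed.

HB.instance Definition _ :=
  GRing.isLinear.Build R R^o M _ scalar_map scalar_map_linear.

End ScalarMap.

Lemma regular_scale1 (r : R) : r *: (1 : R^o) = r :> R^o.
Proof. exact: mulr1. Qed.

Lemma projective_regular : projective (R^o : lmodType R).
Proof.
move=> A B g h gsurj; have [a ga] := gsurj (h 1).
exists (scalar_map a : {linear R^o -> A}) => r; rewrite /scalar_map linearZ /= ga.
by rewrite -linearZ regular_scale1.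
Qed.

Lemma projective_dsum (I : Type) P : projective P -> projective (dsum I P).
Proof.
move=> projP A B g h gsurj.
have lift_i (i : {classic I}) : exists h' : {linear P -> A},
    forall x, g (h' x) = h (dinj i x).
  exact: (projP A B g (h \o dinj i : {linear P -> B}) gsurj).
have {lift_i}/choice[h' h'P] := lift_i.
exists (dsum_lift h' : {linear dsum I P -> A}) => x.
have [r ur r0] := dsum_support (fun _ : 'I_1 => x).
rewrite /= (dsum_liftE _ ur (r0 ord0)) linear_sum.
rewrite [in RHS](dsum_decomp ur (r0 ord0)) linear_sum.
by apply: eq_bigr => i _; exact: h'P.
Qed.

Lemma projective_section M N (g : {linear M -> N}) : projective N ->
  (forall y, exists x, g x = y) -> exists f : {linear N -> M}, cancel f g.
Proof. by move=> projN gsurj; exact: (projN M N g idfun gsurj). Qed.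

Lemma projective_retract_free P : projective P ->
  exists (I : Type) (f : {linear P -> dsum I R^o}) (g : {linear dsum I R^o -> P}),
    cancel f g.
Proof.
move=> projP.
pose g : {linear dsum P R^o -> P} :=
  dsum_lift (fun p : {classic P} => scalar_map (p : P)).
have [|f fK] := @projective_section _ _ g projP; last by exists P, f, g.
move=> p; exists (dinj (p : {classic P}) (1 : R^o)).
by rewrite /g /= dsum_lift_dinj /= /scalar_map scale1r.
Qed.

Section FreeTuple.
Variables (I : Type) (n : nat) (a : 'I_n -> dsum I R^o).

(** A finite tuple in a free module is the image of a matrix over R, with
    respect to the finitely many basis elements that occur in it. *)
Lemma free_tuple : exists k (C : 'M[R]_(n, k)) (b : 'I_k -> {classic I}),
  [/\ injective b, forall i, a i = \sum_l C i l *: dinj (b l) (1 : R^o) &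
      forall i l, dcoord (b l) (a i) = C i l].
Proof.
have [r ur r0] := dsum_support a.
exists (size r), (\matrix_(i, l) dcoord (tnth (in_tuple r) l) (a i)),
  (tnth (in_tuple r)).
split=> [|i|i l]; [exact/tuple_uniqP | | by rewrite mxE].
rewrite {1}(dsum_decomp ur (r0 i)) (big_tnth _ _ r); apply: eq_bigr => l _.
by rewrite mxE -linearZ regular_scale1.
Qed.

End FreeTuple.

Lemma eq_flat_free (I : Type) : eq_flat (dsum I R^o).
Proof.
apply/eq_flatP => n c m cm; have [k [C [b [_ mE mC]]]] := free_tuple m.
exists k, (fun i l => C i l), (fun l => dinj (b l) (1 : R^o)); split=> // l.
rewrite -[RHS](linear0 (dcoord (M := R^o) (b l))) -cm linear_sum.
by apply: eq_bigr => i _; rewrite linearZ /= mC.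
Qed.

(** If a = C b for elements b of a basis, then every y = C z, in any module, is
    the image of a under a linear map, so the formula C | x generates pp(a). *)
Lemma mittag_leffler_free (I : Type) : mittag_leffler (dsum I R^o).
Proof.
move=> n a; have [k [C [b [binj aE _]]]] := free_tuple a.
exists (pp_dvd C).
  by apply/pp_dvdP; exists (fun l => dinj (b l) (1 : R^o)).
move=> psi psia K x /pp_dvdP[z xE].
pose zb (i : {classic I}) : K := \sum_(l | b l == i) z l.
pose h : {linear dsum I R^o -> K} := dsum_lift (fun i => scalar_map (zb i)).
rewrite (_ : x = h \o a); first exact: pp_sol_linear.
apply/funext => i; rewrite /= aE linear_sum xE; apply: eq_bigr => l _.
rewrite linearZ /h /= dsum_lift_dinj /= /scalar_map scale1r /zb.
by rewrite (big_pred1 l) // => j; rewrite (inj_eq binj).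
Qed.

Lemma eq_flat_retract M N (f : {linear M -> N}) (g : {linear N -> M}) :
  cancel f g -> eq_flat N -> eq_flat M.
Proof.
move=> fK /eq_flatP flatN; apply/eq_flatP => n c m cm.
have [|k [D [w [mE cD]]]] := flatN n c (f \o m).
  rewrite -[RHS](linear0 f) -cm linear_sum; apply: eq_bigr => i _.
  by rewrite linearZ.
exists k, D, (g \o w); split=> // i; rewrite -[LHS]fK [f _]mE linear_sum.
by apply: eq_bigr => l _; rewrite linearZ.
Qed.

Lemma mittag_leffler_pp_type M N (f : M -> N) :
  (forall n (a : 'I_n -> M), pp_type (f \o a) = pp_type a) ->
  mittag_leffler N -> mittag_leffler M.
Proof. by move=> fpp mlN n a; rewrite -fpp; exact: mlN. Qed.

Lemma pp_type_retract M N (f : {linear M -> N}) (g : {linear N -> M}) :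
  cancel f g -> forall n (a : 'I_n -> M), pp_type (f \o a) = pp_type a.
Proof.
move=> fK n a; apply/seteqP; split=> phi /=; first by move/(pp_sol_retract phi a fK).
by move=> ?; exact/(pp_sol_retract phi a fK).
Qed.

Lemma projective_eq_flat P : projective P -> eq_flat P.
Proof.
move=> /projective_retract_free[I [f [g fK]]].
exact: eq_flat_retract fK (@eq_flat_free I).
Qed.

Lemma projective_mittag_leffler P : projective P -> mittag_leffler P.
Proof.
move=> /projective_retract_free[I [f [g fK]]].
apply: (mittag_leffler_pp_type _ (@mittag_leffler_free I)).
exact: pp_type_retract fK.
Qed.

End Projective.

(** * Flat modules over a ring with dcc on principal right ideals *)

Section RadicalElements.
Variable R : pzRingType.
Implicit Types a b c e r s u v w : R.

(** Membership in the Jacobson radical, as quasi-regularity of a R. *)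
Definition radical_elt a := forall w, exists v, (1 - a * w) * v = 1.

Lemma radical_elt0 : radical_elt 0.
Proof. by move=> w; exists 1; rewrite mul0r subr0 mulr1. Qed.

Lemma radical_eltMr a r : radical_elt a -> radical_elt (a * r).
Proof. by move=> Ja w; have [v] := Ja (r * w); rewrite mulrA; exists v. Qed.

Lemma radical_elt_fix c a : radical_elt a -> c = c * a -> c = 0.
Proof.
move=> /(_ 1)[v av1] ca; rewrite -[LHS]mulr1 -av1 mulrA mulr1.
by rewrite mulrBr mulr1 -ca subrr mul0r.
Qed.

(** The radical is semiprime, because 1 - c w is a left factor of
    1 - c w c w. *)
Lemma not_radical_elt_conj c :
  ~ radical_elt c -> exists s, ~ radical_elt (c * s * c).
Proof.
move=> Jc; apply: contrapT => /forallNP Jscs; apply: Jc => w.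
have /contrapT /(_ w)[v wv1] := Jscs w; exists ((1 + c * w) * v).
rewrite mulrA -[RHS]wv1; congr (_ * v).
by rewrite mulrDr mulr1 mulrBl mul1r addrA addrNK mulrA.
Qed.

Lemma mul_iter_fix a b n : a = a * b -> a = a * b ^+ n.
Proof.
by move=> ab; elim: n => [|n IHn]; rewrite ?mulr1 // exprS mulrA -ab.
Qed.

Lemma expr1B_comm u n : exists q, GRing.comm u q /\ (1 - u) ^+ n = 1 - u * q.
Proof.
elim: n => [|n [q [uq IHn]]].
  by exists 0; rewrite mulr0 subr0; split=> //; exact: commr0.
exists (1 + q - u * q); split.
  apply: commrB; first by apply: commrD => //; exact: commr1.
  by apply: commrM.
rewrite exprS IHn mulrBl mul1r !mulrBr mulrDr !mulr1 !opprB opprD -addrA.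
by congr (_ + _); rewrite addrCA; congr (_ + _); rewrite addrC.
Qed.

(** If u - u^2 is nilpotent then some power of u is von Neumann regular, with
    an inverse that commutes with u. *)
Lemma nilpotent_idempotent u n : (u - u * u) ^+ n = 0 ->
  exists z, [/\ GRing.comm u z & u ^+ n = u ^+ n * u ^+ n * z].
Proof.
have u1u : GRing.comm u (1 - u) by apply: commrB => //; exact: commr1.
have -> : u - u * u = u * (1 - u) by rewrite mulrBr mulr1.
have [q [uq qE]] := expr1B_comm u n.
rewrite exprMn_comm // qE mulrBr mulr1 => /subr0_eq /(mul_iter_fix n) un.
exists (q ^+ n); split; first exact: commrX.
by rewrite {1}un exprMn_comm // mulrA.
Qed.

Definition local_idempotent e := [/\ e * e = e, ~ radical_elt e &
  forall r, ~ radical_elt (e * r) -> exists s, e = e * r * s].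

Hypothesis dcc : dcc_principal_right_ideals R.

Lemma minimal_right_ideal (P : R -> Prop) a : P a ->
  exists2 c, P c & forall r, P (c * r) -> exists s, c = c * r * s.
Proof.
move=> Pa; apply: contrapT => noc.
have next (c : {c | P c}) : exists d : {c | P c},
    (exists r, sval d = sval c * r) /\ forall s, sval c <> sval d * s.
  case: c => c Pc /=; apply: contrapT => nod; apply: noc; exists c => // r Pcr.
  apply: contrapT => nos; apply: nod; exists (exist _ (c * r) Pcr).
  by split=> [|s cE]; [exists r | apply: nos; exists s].
have {next}/choice[next nextP] := next.
pose seqc i := sval (iter i next (exist _ a Pa)).
have [i|n stab] := dcc (a := seqc).
  have [[s sE] _] := nextP (iter i next (exist _ a Pa)).
  move=> x [r ->]; rewrite [seqc i.+1]sE.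
  by exists (s * r); rewrite mulrA.
have : principal_right_ideal (seqc n) (seqc n) by exists 1; rewrite mulr1.
rewrite -(stab n.+1) // => -[r nE].
by have [_ /(_ r)] := nextP (iter n next (exist _ a Pa)).
Qed.

Lemma radical_elt_nilpotent k : radical_elt k -> exists n, k ^+ n.+1 = 0.
Proof.
move=> Jk; have [i|n stab] := dcc (a := fun i => k ^+ i).
  by move=> ? [r ->]; exists (k * r); rewrite mulrA -exprSr.
have : principal_right_ideal (k ^+ n) (k ^+ n) by exists 1; rewrite mulr1.
rewrite -(stab n.+1) // => -[r]; rewrite exprSr -mulrA.
move=> /(radical_elt_fix (radical_eltMr r Jk)) kn0.
by exists n; rewrite exprS kn0 mulr0.
Qed.

(** A right ideal that is minimal among the principal ones outside the radical
    contains a u with a u = a for a generator a of it; then u - u^2 is killed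
    by a, hence lies in the radical and is nilpotent, and a power of u is an
    idempotent up to a factor that commutes with u. *)
Lemma minimal_local_idempotent c : ~ radical_elt c ->
  (forall r, ~ radical_elt (c * r) -> exists s, c = c * r * s) ->
  exists2 e, local_idempotent e & exists r, e = c * r.
Proof.
move=> Jc minc; have [s Jcsc] := not_radical_elt_conj Jc.
have [t ct] : exists t, c = c * s * c * t.
  by have := minc (s * c); rewrite !mulrA; exact.
pose a := c * s.
have Ja : ~ radical_elt a.
  by move=> /(radical_eltMr (c * t)); rewrite mulrA -ct.
have [t' ct'] := minc s Ja.
pose u := a * (t' * t * s).
have au : a * u = a.
  transitivity (a * (a * t') * t * s); first by rewrite !mulrA.
  by rewrite -[a * t']ct' -[a * c * t]ct.
have a_neq0 : a <> 0 by move=> a0; apply: Ja; rewrite a0; exact: radical_elt0.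
have uc : exists r, u = c * r by exists (s * (t' * t * s)); rewrite mulrA.
have Jk : radical_elt (u - u * u).
  have ak : a * (u - u * u) = 0 by rewrite mulrBr mulrA au au subrr.
  have [r ur] := uc.
  have kE : u - u * u = c * (r * (1 - u)) by rewrite mulrA -ur mulrBr mulr1.
  apply: contrapT; rewrite {1}kE => /minc[y]; rewrite -kE => cy.
  have c0 : c = 0 by rewrite ct -/a {1}cy mulrA ak !mul0r.
  by apply: Jc; rewrite c0; exact: radical_elt0.
have [n /nilpotent_idempotent[z [uz un]]] := radical_elt_nilpotent Jk.
have uzn : GRing.comm (u ^+ n.+1) z by apply/commr_sym/commrX/commr_sym.
pose e := u ^+ n.+1 * z.
have ue : u ^+ n.+1 = e * u ^+ n.+1 by rewrite /e -mulrA -uzn mulrA -un.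
have Je : ~ radical_elt e.
  move=> /(radical_eltMr (u ^+ n.+1)); rewrite -ue => /radical_elt_fix Jun.
  by apply/a_neq0/Jun/mul_iter_fix; rewrite au.
have [r er] : exists r, e = c * r.
  by have [r ur] := uc; exists (r * u ^+ n * z); rewrite /e exprS {1}ur !mulrA.
exists e; last by exists r.
have [y cy] : exists y, c = e * y by rewrite er; apply: minc; rewrite -er.
split=> // [|x].
  by rewrite {2}/e mulrA -ue.
rewrite er -mulrA => /minc[x' cx']; exists (x' * r).
by rewrite !mulrA -[c * r * x]mulrA -cx'.
Qed.

Section ProperSubgroup.
Variables (M : lmodType R) (H : set M).
Hypothesis HD : forall x y, H x -> H y -> H (x + y).
Hypothesis HJ : forall a x, radical_elt a -> H (a *: x).

(** Let f be an idempotent with f M not inside H and f R minimal. A local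
    idempotent e in f R splits f into e and f - e, and f - e maps M into H
    because (f - e) R is smaller than f R. *)
Lemma local_idempotent_outside m : ~ H m ->
  exists e, local_idempotent e /\ exists x, ~ H (e *: x).
Proof.
move=> Hm.
have [|f [ff [x Hx]] minf] := @minimal_right_ideal
    (fun d => d * d = d /\ exists x, ~ H (d *: x)) 1.
  by rewrite mulr1; split=> //; exists m; rewrite scale1r.
have Jf : ~ radical_elt f by move=> /HJ.
have [|c [Jc [r cr]] minc] := @minimal_right_ideal
    (fun d => ~ radical_elt d /\ exists r, d = f * r) f.
  by split=> //; exists 1; rewrite mulr1.
have [r' Jr'|e [ee Je mine] [r' er']] := minimal_local_idempotent Jc.
  by apply: minc; split=> //; exists (r * r'); rewrite cr mulrA.
have fe : f * e = e by rewrite er' cr !mulrA ff.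
have e'e' : e * f * (e * f) = e * f by rewrite mulrA -[e * f * e]mulrA fe ee.
have Jef : ~ radical_elt (e * f).
  by move=> /(radical_eltMr e); rewrite -mulrA fe ee.
have gg : (f - e * f) * (f - e * f) = f - e * f.
  by rewrite mulrBr !mulrBl ff e'e' mulrA fe -mulrA ff subrr subr0.
have Hg y : H ((f - e * f) *: y).
  apply: contrapT => Hgy; have gE : f - e * f = f * (1 - e * f).
    by rewrite mulrBr mulr1 mulrA fe.
  have [|s fs] := minf (1 - e * f); first by rewrite -gE; split=> //; exists y.
  apply: Jef; rewrite fs -gE mulrA mulrBr [e * (e * f)]mulrA ee subrr mul0r.
  exact: radical_elt0.
exists (e * f); split; last first.
  exists x => Hex; apply: Hx; rewrite -[f](subrK (e * f)) scalerDl.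
  exact: HD.
split=> // y; rewrite -mulrA => /mine[s es]; exists (s * f).
by rewrite {1}es !mulrA.
Qed.

End ProperSubgroup.

Section CyclicSummand.
Variables (M : lmodType R) (N : set M).
Hypotheses (N0 : N 0) (NP : forall a x y, N x -> N y -> N (a *: x + y)).
Hypothesis flatN : eq_criterion N.

Let NZ a x : N x -> N (a *: x).
Proof. by move=> Nx; rewrite -[_ *: _]addr0; exact: NP. Qed.

Let ND x y : N x -> N y -> N (x + y).
Proof. by move=> Nx; rewrite -[x]scale1r; exact: NP. Qed.

Let N_sum k (x : 'I_k -> M) : (forall i, N (x i)) -> N (\sum_i x i).
Proof. by move=> Nx; elim/big_ind: _ => // i _; exact: Nx. Qed.

Definition radical_sum (y : M) := exists n k (a : 'I_k -> R) (x : 'I_k -> M),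
  [/\ N n, forall i, radical_elt (a i) & y = n + \sum_i a i *: x i].

Lemma radical_sumD x y : radical_sum x -> radical_sum y -> radical_sum (x + y).
Proof.
move=> [n [k [a [z [Nn Ja ->]]]]] [n' [k' [a' [z' [Nn' Ja' ->]]]]].
have [b [bl br]] := ord_cat a a'; have [w [wl wr]] := ord_cat z z'.
exists (n + n'), (k + k')%N, b, w; split; first exact: ND.
  by move=> i; case: (split_ordP i) => {}i ->; rewrite ?bl ?br.
rewrite big_split_ord /= addrACA; congr (_ + (_ + _)).
  by apply: eq_bigr => i _; rewrite bl wl.
by apply: eq_bigr => i _; rewrite br wr.
Qed.

Lemma radical_sumJ a x : radical_elt a -> radical_sum (a *: x).
Proof.
move=> Ja; exists 0, 1%N, (fun=> a), (fun=> x).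
by split=> //; rewrite big_ord1 add0r.
Qed.

(** Nakayama's lemma for M / N: if c R is minimal among the principal right
    ideals that do not map M into N, then c a maps M into N for radical a. *)
Lemma radical_sum_proper x : ~ N x -> exists y, ~ radical_sum y.
Proof.
move=> Nx; apply: contrapT => /forallNP full.
have [|c [m Ncm] minc] := @minimal_right_ideal (fun d => exists m, ~ N (d *: m)) 1.
  by exists x; rewrite scale1r.
have [n [k [a [y [Nn Ja mE]]]]] := contrapT (full m).
apply: Ncm; rewrite mE scalerDr scaler_sumr; apply: ND; first exact: NZ.
apply: N_sum => i; rewrite scalerA; apply: contrapT => Ncai.
have [|s cs] := minc (a i); first by exists (y i).
have c0 : c = 0 by apply: (radical_elt_fix (radical_eltMr s (Ja i))); rewrite mulrA.
by apply: Ncai; rewrite c0 mul0r scale0r.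
Qed.

Variables (e : R) (m0 : M).
Hypotheses (e_local : local_idempotent e) (em0 : ~ radical_sum (e *: m0)).

(** As e m0 is not radical modulo N, one of the coefficients e d l in every
    expansion of e m0 modulo N generates e R. *)
Lemma relation_with_local n (c : 'I_n -> R) (m : 'I_n -> M) r :
  N (\sum_i c i *: m i - (r * e) *: m0) ->
  exists k (D : 'I_n -> 'I_k -> R) (d : 'I_k -> R) (w : 'I_k -> M),
  [/\ forall i, N (m i - \sum_l D i l *: w l),
      N (m0 - \sum_l d l *: w l),
      forall l, \sum_i c i * D i l = r * e * d l &
      exists l s, e = e * d l * s].
Proof.
move=> Nrel; have [_ _ mine] := e_local.
have [|k [D [w [mE cD]]]] := flatN (c := ext_val (- (r * e) : R^o) c)
    (m := ext_val m0 m).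
  rewrite big_ord_recl !ext_val0 scaleNr addrC.
  by under eq_bigr do rewrite !ext_valS.
exists k, (fun i => D (lift ord0 i)), (D ord0), w; split=> [i||l|].
- by have := mE (lift ord0 i); rewrite ext_valS.
- by have := mE ord0; rewrite ext_val0.
- have := cD l; rewrite big_ord_recl ext_val0 mulNr => /eqP.
  rewrite addrC subr_eq0 => /eqP <-.
  by apply: eq_bigr => i _; rewrite ext_valS.
apply: contrapT => none; apply: em0.
exists (e *: (m0 - \sum_l D ord0 l *: w l)), k, (fun l => e * D ord0 l), w.
split=> [|l|]; first by apply: NZ; have := mE ord0; rewrite ext_val0.
  apply: contrapT => /mine[s es]; apply: none; exists l, s; exact: es.
rewrite scalerBr -[LHS](subrK (e *: \sum_l D ord0 l *: w l)); congr (_ + _).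
by rewrite scaler_sumr; apply: eq_bigr => l _; rewrite scalerA.
Qed.

Lemma annihilator_local r : N ((r * e) *: m0) -> r * e = 0.
Proof.
move=> Nre; have [|k [D [d [w [_ _ red [l [s es]]]]]]] :=
    @relation_with_local 0 (fun=> 0) (fun=> 0) (- r).
  by rewrite big_ord0 add0r mulNr scaleNr opprK.
rewrite es !mulrA; have := red l; rewrite big_ord0 !mulNr => /eqP.
by rewrite eq_sym oppr_eq0 => /eqP ->; rewrite mul0r.
Qed.

(** A relation modulo N + R e m0 is a relation modulo N that also involves a
    multiple r e of m0. The expansions of the m i are corrected by multiples of
    e m0, which vanishes in the quotient, so as to cancel this contribution. *)
Lemma eq_criterion_extend :
  eq_criterion (fun y => exists2 n, N n & exists r, y = n + r *: (e *: m0)).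
Proof.
move=> n c m [n0 Nn0 [r cmE]].
have [ee _ _] := e_local.
have [|k [D [d [w [mE m0E red [l0 [s es]]]]]]] := @relation_with_local n c m r.
  by rewrite cmE scalerA addrK.
(* The expansion of e m0, times D i l0 * s, is subtracted. As e d l0 s = e, this
   changes the relation by r e d l0 s e d l = r e d l, which is its value. *)
exists k, (fun i l => D i l - D i l0 * s * (e * d l)), w; split=> [i|l].
  exists (m i - \sum_l D i l *: w l -
          (D i l0 * s * e) *: (m0 - \sum_l d l *: w l)).
    by rewrite addrC -scaleNr; apply: NP.
  exists (D i l0 * s).
  have -> : \sum_l (D i l - D i l0 * s * (e * d l)) *: w l =
      \sum_l D i l *: w l - (D i l0 * s * e) *: \sum_l d l *: w l.
    rewrite scaler_sumr -sumrB; apply: eq_bigr => l _.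
    by rewrite scalerBl scalerA !mulrA.
  rewrite opprB scalerBr [in RHS]opprB scalerA -[RHS]addrA subrK.
  by rewrite [RHS]addrAC addrA.
under eq_bigr do rewrite mulrBr; rewrite sumrB red.
have -> : \sum_i c i * (D i l0 * s * (e * d l)) =
    r * (e * d l0 * s) * e * d l; last first.
  by rewrite -es -(mulrA r e e) ee subrr.
transitivity ((\sum_i c i * D i l0) * (s * e * d l)); last by rewrite red !mulrA.
by rewrite mulr_suml; apply: eq_bigr => i _; rewrite !mulrA.
Qed.

End CyclicSummand.
End RadicalElements.

Section PerfectFromDcc.
Variable R : pzRingType.
Hypothesis dcc : dcc_principal_right_ideals R.

Section Lifting.
Variables (M A B : lmodType R) (g : {linear A -> B}) (h : {linear M -> B}).
Hypothesis gsurj : forall b, exists a, g a = b.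

Definition dom (G : set (M * A)) : set M := [set x | exists a, G (x, a)].

(** The graph of a lift of h along g to a submodule N such that M / N is flat. *)
Definition partial_lift (G : set (M * A)) :=
  [/\ G (0, 0), forall r x a y b, G (x, a) -> G (y, b) -> G (r *: x + y, r *: a + b),
      forall a, G (0, a) -> a = 0, forall x a, G (x, a) -> g a = h x &
      eq_criterion (dom G)].

Lemma partial_lift_extend (G : set (M * A)) x0 : partial_lift G -> ~ dom G x0 ->
  exists2 G', partial_lift G' & G `<` G'.
Proof.
move=> [G0 GP Gfun Glift flatG] Gx0.
have N0 : dom G 0 by exists 0.
have NP r x y : dom G x -> dom G y -> dom G (r *: x + y).
  by move=> [a Ga] [b Gb]; exists (r *: a + b); exact: GP.
have [y /(local_idempotent_outside dcc (radical_sumD NP) (radical_sumJ N0))] :=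
  radical_sum_proper dcc N0 NP Gx0.
move=> [e [e_local [m0 em0]]]; have [ee _ _] := e_local.
have [a0 ga0] := gsurj (h m0).
pose G' : set (M * A) := [set p | exists2 q, G q &
  exists r, p = (q.1 + r *: (e *: m0), q.2 + r *: (e *: a0))].
exists G'; last first.
  split=> [[x a] Gxa|sub].
    by exists (x, a) => //; exists 0; rewrite /= !scale0r !addr0.
  apply: em0; exists (e *: m0), 0%N, (fun=> 0), (fun=> 0).
  rewrite big_ord0 addr0; split=> //; last by case.
  exists (e *: a0); apply: sub; exists (0, 0) => //; exists 1.
  by rewrite /= !scale1r !add0r.
split.
- by exists (0, 0) => //; exists 0; rewrite /= !scale0r !addr0.
- move=> r x a y' b [[u v] Guv [s [-> ->]]] [[u' v'] Guv' [s' [-> ->]]] /=.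
  exists (r *: u + u', r *: v + v'); first exact: GP.
  exists (r * s + s'); rewrite /= !scalerDr !scalerDl !(scalerA r s).
  by rewrite !(addrACA _ _ u') !(addrACA _ _ v').
- move=> a [[u v] Guv [r [/esym u0 ->]]] /=.
  have re0 : r * e = 0.
    apply: (annihilator_local N0 NP flatG e_local em0).
    exists (- v); have -> : (r * e) *: m0 = - u.
      by apply/eqP; rewrite -scalerA -addr_eq0 addrC u0.
    by rewrite -[- u]addr0 -[- v]addr0 -scaleN1r -(scaleN1r v); exact: GP.
  move: u0; rewrite /= !scalerA re0 !scale0r !addr0 => u0.
  by apply: Gfun; rewrite -u0.
- move=> x a [[u v] Guv [r [-> ->]]] /=.
  by rewrite !linearD !linearZ /= ga0 (Glift u).
have := eq_criterion_extend N0 NP flatG e_local em0.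
congr eq_criterion; apply/seteqP; split=> y' /=.
  move=> [n [a Ga] [r ->]]; exists (a + r *: (e *: a0)), (n, a) => //.
  by exists r.
by move=> [a [[u v] Guv [r [-> _]]]]; exists u; [exists v | exists r].
Qed.

Hypothesis flatM : eq_flat M.

Lemma partial_lift0 : partial_lift [set (0, 0)].
Proof.
split=> //= [r x a y b [-> ->] [-> ->]|a [//]|x a [-> ->]|].
- by rewrite !scaler0 !addr0.
- by rewrite !linear0.
have := flatM; rewrite /eq_flat; congr eq_criterion.
by apply/seteqP; split=> [x ->|x [a [->]]]; [exists 0|].
Qed.

Lemma total_lift_exists : exists2 G, partial_lift G & forall x, dom G x.
Proof.
(* The union of an empty chain is empty: adding (0, 0) makes it a graph. *)
pose Z : set (M * A) := [set (0, 0)].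
have [F chainF tot|X [liftX maxX]] := @Zorn_bigcup _ [set X | partial_lift (X `|` Z)].
  pose U := \bigcup_(X in F) X `|` Z.
  have both p q : U p -> U q ->
      exists G, [/\ partial_lift G, G `<=` U, G p & G q].
    have inF X : F X -> X `|` Z `<=` U.
      by move=> FX x [Xx|Zx]; [left; exists X | right].
    move=> [[X FX Xp]|Zp] [[Y FY Yq]|Zq].
    - have [XY|YX] := tot X Y FX FY.
        by exists (Y `|` Z); split; [exact: chainF | exact: inF | left; exact: XY | left].
      by exists (X `|` Z); split; [exact: chainF | exact: inF | left | left; exact: YX].
    - by exists (X `|` Z); split; [exact: chainF | exact: inF | left | right].
    - by exists (Y `|` Z); split; [exact: chainF | exact: inF | right | left].
    - by exists Z; split; [exact: partial_lift0 | move=> x; right | |].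
  split.
  - by right.
  - move=> r x a y b /both Ux /Ux[G [[_ GP _ _ _] GU Gx Gy]].
    by apply: GU; exact: GP.
  - by move=> a /[dup] /both Ua /Ua[G [[_ _ Gfun _ _] _ Ga _]]; exact: Gfun.
  - by move=> x a /[dup] /both Ua /Ua[G [[_ _ _ Glift _] _ Ga _]]; exact: Glift.
  move=> n c m [a /[dup] /both Ua /Ua[G [[_ _ _ _ flatG] GU Ga _]]].
  have [|k [D [w [mE cD]]]] := flatG n c m; first by exists a.
  by exists k, D, w; split=> // i; have [b /GU Ub] := mE i; exists b.
exists (X `|` Z) => // x; apply: contrapT => Xx.
have [G liftG [XG GX]] := partial_lift_extend liftX Xx.
apply: (maxX G); last first.
  suff GZ : G `|` Z = G by rewrite /= GZ.
  apply/seteqP; split=> [p [//|->]|p]; last by left.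
  by have [] := liftG.
split=> [p Xp|GX']; first by apply: XG; left.
by apply: GX => p /GX'; left.
Qed.

Lemma linear_lift : exists h' : {linear M -> A}, forall x, g (h' x) = h x.
Proof.
have [G [G0 GP Gfun Glift _] /choice[f fG]] := total_lift_exists.
have Guniq x a b : G (x, a) -> G (x, b) -> a = b.
  move=> Ga Gb; have := GP (-1) x a x b Ga Gb.
  by rewrite !scaleN1r addNr => /Gfun/eqP; rewrite addrC subr_eq0 => /eqP.
have flin : linear f.
  by move=> r x y; apply: (Guniq (r *: x + y)) (fG _) _; exact: GP.
exists (HB.pack_for {linear M -> A} f (GRing.isLinear.Build R M A _ f flin)) => x.
exact: Glift.
Qed.

End Lifting.

Lemma dcc_left_perfect : left_perfect R.
Proof.
move=> M /flat_eq_flat flatM A B g h gsurj; exact: linear_lift.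
Qed.

End PerfectFromDcc.

(** * Quotient modules and sequential direct limits *)

Section QuotientModule.
Variables (R : pzRingType) (M : lmodType R) (S : submodClosed M).

Definition quot_kernel : {pred M} := fun x => x \in S.

Lemma quot_kernel_zmod : zmod_closed quot_kernel.
Proof.
split=> [|x y xS yS]; first exact: rpred0.
by rewrite unfold_in rpredD // -scaleN1r rpredZ.
Qed.

HB.instance Definition _ := GRing.isZmodClosed.Build M quot_kernel quot_kernel_zmod.

Definition quot_module := Quotient.quot quot_kernel.

HB.instance Definition _ := GRing.Zmodule.on quot_module.

Definition quot_class (x : M) : quot_module := (\pi_quot_module x)%qT.

Lemma quot_class_eq x y : quot_class x = quot_class y <-> x - y \in S.
Proof.
split=> [/eqP|xy]; first by rewrite -Quotient.idealrBE.
by apply/eqP; rewrite -Quotient.idealrBE.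
Qed.

Lemma quot_class_surj (q : quot_module) : exists x, q = quot_class x.
Proof. by exists (repr q); rewrite /quot_class reprK. Qed.

Lemma quot_classD x y : quot_class (x + y) = quot_class x + quot_class y.
Proof. exact: Quotient.pi_add. Qed.

Definition quot_scale (a : R) (q : quot_module) : quot_module :=
  quot_class (a *: repr q).

Lemma quot_scaleE a x : quot_scale a (quot_class x) = quot_class (a *: x).
Proof.
apply/quot_class_eq; rewrite -scalerBr rpredZ //; apply/quot_class_eq.
by rewrite /quot_class reprK.
Qed.

Lemma quot_scalerA a b q : quot_scale a (quot_scale b q) = quot_scale (a * b) q.
Proof. by have [x ->] := quot_class_surj q; rewrite !quot_scaleE scalerA. Qed.

Lemma quot_scale1r : left_id 1 quot_scale.
Proof. by move=> q; have [x ->] := quot_class_surj q; rewrite quot_scaleE scale1r. Qed.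

Lemma quot_scalerDr : right_distributive quot_scale +%R.
Proof.
move=> a p q; have [x ->] := quot_class_surj p; have [y ->] := quot_class_surj q.
by rewrite -quot_classD !quot_scaleE scalerDr quot_classD.
Qed.

Lemma quot_scalerDl q : {morph quot_scale^~ q : a b / a + b}.
Proof.
by move=> a b; have [x ->] := quot_class_surj q; rewrite !quot_scaleE scalerDl quot_classD.
Qed.

HB.instance Definition _ := GRing.Zmodule_isLmodule.Build R quot_module
  quot_scalerA quot_scale1r quot_scalerDr quot_scalerDl.

Lemma quot_class_linear : linear quot_class.
Proof. by move=> a x y; rewrite quot_classD -quot_scaleE. Qed.

HB.instance Definition _ :=
  GRing.isLinear.Build R M quot_module _ quot_class quot_class_linear.

Lemma quot_class_eq0 x : quot_class x = 0 <-> x \in S.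
Proof.
by rewrite -(linear0 quot_class) quot_class_eq subr0.
Qed.

End QuotientModule.

Section SequentialLimit.
Variables (R : pzRingType) (F : lmodType R) (f : nat -> {linear F -> F}).

Fixpoint transition n k : F -> F :=
  if k is k'.+1 then f (n + k') \o transition n k' else idfun.

Lemma transition_linear n k : linear (transition n k).
Proof. by elim: k => [//|k IHk] a x y /=; rewrite IHk linearP. Qed.

HB.instance Definition _ n k :=
  GRing.isLinear.Build R F F _ (transition n k) (transition_linear n k).

Lemma transitionD n k k' x :
  transition (n + k) k' (transition n k x) = transition n (k + k') x.
Proof. by elim: k' => [|k' IHk]; rewrite ?addn0 // addnS /= IHk addnA. Qed.

Definition eventually_zero : {pred nat -> F} :=
  fun u => `[< exists n, forall i, (n <= i)%N -> u i = 0 >].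

Lemma eventually_zero_submod : submod_closed eventually_zero.
Proof.
split=> [|a u v /asboolP[n un] /asboolP[p vp]]; apply/asboolP; first by exists 0%N.
exists (maxn n p) => i; rewrite geq_max => /andP[ni pi].
suff : a *: u i + v i = 0 by [].
by rewrite un // vp // scaler0 addr0.
Qed.

HB.instance Definition _ := GRing.isSubmodClosed.Build R (nat -> F) eventually_zero
  eventually_zero_submod.

Definition tail_module := quot_module eventually_zero.

Definition tail n (x : F) : tail_module :=
  quot_class _ (fun i => if (i < n)%N then 0 else transition n (i - n) x).

Lemma tail_linear n : linear (tail n).
Proof.
move=> a x y; rewrite /tail -linearP; congr (quot_class _ _); apply/funext => i.
suff : (if (i < n)%N then 0 else transition n (i - n) (a *: x + y)) =
    a *: (if (i < n)%N then 0 else transition n (i - n) x) +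
    (if (i < n)%N then 0 else transition n (i - n) y) by [].
by case: ifP; rewrite ?scaler0 ?addr0 ?linearP.
Qed.

HB.instance Definition _ n :=
  GRing.isLinear.Build R F tail_module _ (tail n) (tail_linear n).

Lemma tail_shift n k x : tail n x = tail (n + k) (transition n k x).
Proof.
apply/quot_class_eq/asboolP; exists (n + k)%N => i nki.
have ni : (n <= i)%N := leq_trans (leq_addr _ _) nki.
suff : (if (i < n)%N then 0 else transition n (i - n) x) -
    (if (i < n + k)%N then 0 else transition (n + k) (i - (n + k)) (transition n k x))
    = 0 by [].
by rewrite !ltnNge nki ni /= transitionD subnDA subnKC ?subrr // leq_subRL.
Qed.

Lemma tail_eq0 n x : tail n x = 0 -> exists k, transition n k x = 0.
Proof.
move=> /quot_class_eq0/asboolP[k k0]; exists k.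
by have := k0 (n + k)%N (leq_addl _ _); rewrite ltnNge leq_addr /= addKn.
Qed.

(** The direct limit of F -> F -> ... along the maps f i, inside the module of
    sequences modulo eventual equality. *)
Definition seq_limit_pred : {pred tail_module} :=
  fun q => `[< exists n x, q = tail n x >].

Lemma seq_limit_submod : submod_closed seq_limit_pred.
Proof.
split=> [|a u v /asboolP[n [x ->]] /asboolP[p [y ->]]]; apply/asboolP.
  by exists 0%N, 0; rewrite linear0.
exists (n + p)%N; rewrite (tail_shift n p) (tail_shift p n) [(p + n)%N]addnC.
by eexists; rewrite -linearP.
Qed.

HB.instance Definition _ := GRing.isSubmodClosed.Build R tail_module seq_limit_pred
  seq_limit_submod.

Definition seq_limit : lmodType R := submod seq_limit_pred.

Lemma tail_in_limit n x : tail n x \in seq_limit_pred.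
Proof. by apply/asboolP; exists n, x. Qed.

Definition to_limit n (x : F) : seq_limit := exist _ (tail n x) (tail_in_limit n x).

Lemma to_limit_linear n : linear (to_limit n).
Proof. by move=> a x y; apply/val_inj; rewrite /= linearP. Qed.

HB.instance Definition _ n :=
  GRing.isLinear.Build R F seq_limit _ (to_limit n) (to_limit_linear n).

Lemma to_limit_shift n k x : to_limit n x = to_limit (n + k) (transition n k x).
Proof. exact/val_inj/tail_shift. Qed.

Lemma to_limit_eq0 p n (x : 'I_p -> F) : (forall i, to_limit n (x i) = 0) ->
  exists k, forall i, transition n k (x i) = 0.
Proof.
move=> x0; have /choice[k kP] i : exists k, transition n k (x i) = 0.
  exact/tail_eq0/(congr1 val (x0 i)).
exists (\sum_i k i)%N => i.
by rewrite (bigD1 i) //= -transitionD kP linear0.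
Qed.

Lemma to_limit_surj p n (q : 'I_p -> seq_limit) :
  exists k (x : 'I_p -> F), forall i, q i = to_limit (n + k) (x i).
Proof.
have lift i : exists kx : nat * F, q i = to_limit kx.1 kx.2.
  have /asboolP[k [x qE]] := valP (q i); exists (k, x); exact: val_inj.
have {lift}/choice[kx kxP] := lift.
pose s := (\sum_i (kx i).1)%N.
have ks i : ((kx i).1 <= n + s)%N by rewrite /s (bigD1 i) //= addnCA leq_addr.
exists s, (fun i => transition (kx i).1 (n + s - (kx i).1) (kx i).2) => i.
by rewrite kxP (to_limit_shift _ (n + s - (kx i).1)) subnKC.
Qed.

Lemma eq_flat_seq_limit : eq_flat F -> eq_flat seq_limit.
Proof.
move=> /eq_flatP flatF; apply/eq_flatP => n c m cm.
have [k0 [x mE]] := to_limit_surj 0 m; rewrite add0n in mE.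
have [k /(_ ord0) cx] : exists k, forall _ : 'I_1,
    transition k0 k (\sum_i c i *: x i) = 0.
  apply: to_limit_eq0 => _; rewrite linear_sum -[RHS]cm.
  by apply: eq_bigr => i _; rewrite linearZ mE.
have [|p [D [w [xE cD]]]] := flatF n c (transition k0 k \o x).
  by rewrite -[RHS]cx linear_sum; apply: eq_bigr => i _; rewrite linearZ.
exists p, D, (to_limit (k0 + k) \o w); split=> // i.
rewrite mE (to_limit_shift k0 k) [transition _ _ _]xE linear_sum.
by apply: eq_bigr => l _; rewrite linearZ.
Qed.

Lemma pp_sol_seq_limit n (phi : pp R n) p (x : 'I_n -> F) :
  pp_sol phi seq_limit (to_limit p \o x) ->
  exists k, pp_sol phi F (transition p k \o x).
Proof.
move=> /pp_solP[y ey]; have [k [z yE]] := to_limit_surj p y.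
have [i|k' k'P] := @to_limit_eq0 _ (p + k) (fun i =>
    \sum_j pp_A phi i j *: z j - \sum_j pp_B phi i j *: transition p k (x j)).
  suff e : to_limit (p + k) (\sum_j pp_A phi i j *: z j) =
      to_limit (p + k) (\sum_j pp_B phi i j *: transition p k (x j)).
    by apply/eqP; rewrite linearB subr_eq0; apply/eqP.
  rewrite !linear_sum; transitivity (\sum_j pp_A phi i j *: y j).
    by apply: eq_bigr => j _; rewrite linearZ yE.
  rewrite ey; apply: eq_bigr => j _; rewrite linearZ; congr (_ *: _).
  exact: to_limit_shift.
exists (k + k')%N; apply/pp_solP; exists (transition (p + k) k' \o z) => i.
have /eqP := k'P i; rewrite linearB subr_eq0 => /eqP; rewrite !linear_sum => e.
transitivity (\sum_j transition (p + k) k' (pp_A phi i j *: z j)).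
  by apply: eq_bigr => j _; rewrite linearZ.
by rewrite e; apply: eq_bigr => j _; rewrite linearZ /= transitionD.
Qed.

Lemma generates_seq_limit (I : Type) (e : I -> F) :
  generates (range e) ->
  generates (range (fun p : nat * I => to_limit p.1 (e p.2))).
Proof.
move=> gen q; have [k [x qE]] := to_limit_surj 0 (fun _ : 'I_1 => q).
have [n [c [g [gX xE]]]] := gen (x ord0).
exists n, c, (to_limit (0 + k) \o g); split=> [i|].
  by have [j _ gE] := gX i; exists ((0 + k)%N, j) => //=; rewrite gE.
rewrite (qE ord0) xE linear_sum; apply: eq_bigr => i _.
by rewrite linearZ.
Qed.

End SequentialLimit.

(** * Elimination of quantifiers down to pp formulas *)

Section FreeLike.
Variable R : pzRingType.
Implicit Types (M N : lmodType R) (n : nat).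

(** These two properties determine all Baur-Monk invariants of a module: the
    index of phi(M) /\ psi(M) in phi(M) is 1 if phi(R) lies in psi(R), and
    infinite otherwise. *)
Definition free_like M :=
  (forall phi psi : pp R 1, pp_sol phi R^o `<=` pp_sol psi R^o ->
     pp_sol phi M `<=` pp_sol psi M) /\
  exists (iota : nat -> {linear R^o -> M}) (pi : nat -> {linear M -> R^o}),
    forall i j r, pi i (iota j r) = if i == j then r else 0.

Lemma eq_flat_pp_implication M (phi psi : pp R 1) : eq_flat M ->
  pp_sol phi R^o `<=` pp_sol psi R^o -> pp_sol phi M `<=` pp_sol psi M.
Proof.
move=> flatM sub x /pp_solP[y ey].
pose C i : 'I_(pp_bound phi).+1 -> R :=
  ext_val (- pp_B phi i ord0 : R^o) (fun j => pp_A phi i j : R^o).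
have [i|k [D [w [xyE CD]]]] :=
    eq_flat_system (C := C) (m := ext_val (x ord0) y) flatM.
  rewrite big_ord_recl /C !ext_val0 scaleNr.
  under eq_bigr do rewrite !ext_valS; rewrite ey.
  by rewrite big_ord1 addNr.
have -> : x = fun i => \sum_l (scalar_map (w l) \o (fun=> D ord0 l : R^o)) i.
  by apply/funext => i; rewrite ord1; have := xyE ord0; rewrite ext_val0.
apply: pp_sol_sum => l; apply: (pp_sol_linear (scalar_map (w l))).
apply: sub; apply/pp_solP; exists (fun j => D (lift ord0 j) l : R^o) => i.
have := CD i l; rewrite big_ord_recl /C ext_val0 mulNr => /eqP.
rewrite addrC subr_eq0 => /eqP e; rewrite big_ord1.
by rewrite -[RHS]e; apply: eq_bigr => j _; rewrite ext_valS.
Qed.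

Definition pp_clause n := (pp R n * seq (pp R n))%type.

Definition clause_sat n (c : pp_clause n) M (v : 'I_n -> M) :=
  pp_sol c.1 M v /\ forall q, List.In q c.2 -> ~ pp_sol q M v.

Definition dnf_sat n (d : seq (pp_clause n)) M (v : 'I_n -> M) :=
  exists2 c, List.In c d & clause_sat c v.

Definition pp_definable n (P : forall M, ('I_n -> M) -> Prop) :=
  exists d : seq (pp_clause n), forall M v, free_like M ->
    P M v <-> dnf_sat d v.

Lemma dnf_sat_cons n (c : pp_clause n) d M (v : 'I_n -> M) :
  dnf_sat (c :: d) v <-> clause_sat c v \/ dnf_sat d v.
Proof.
split=> [[c' [<-|cd] c'v]|[cv|[c' cd c'v]]].
- by left.
- by right; exists c'.
- by exists c => //; left.
- by exists c' => //; right.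
Qed.

Lemma dnf_sat_nil n M (v : 'I_n -> M) : ~ dnf_sat [::] v.
Proof. by case. Qed.

Lemma pp_definable_ext n (P Q : forall M, ('I_n -> M) -> Prop) :
  (forall M v, free_like M -> P M v <-> Q M v) -> pp_definable P -> pp_definable Q.
Proof.
by move=> PQ [d dP]; exists d => M v freeM; rewrite -PQ // dP.
Qed.

Lemma pp_definable_clause n (c : pp_clause n) : pp_definable (@clause_sat n c).
Proof.
exists [:: c] => M v _; rewrite dnf_sat_cons; split; first by left.
by case=> // /dnf_sat_nil.
Qed.

Lemma pp_definable_pp n (phi : pp R n) : pp_definable (fun M v => pp_sol phi M v).
Proof.
apply: pp_definable_ext (pp_definable_clause (phi, [::])) => M v _.
by split=> [[]|phiv]; [| split=> // q []].
Qed.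

Lemma pp_definable_or n (P Q : forall M, ('I_n -> M) -> Prop) :
  pp_definable P -> pp_definable Q -> pp_definable (fun M v => P M v \/ Q M v).
Proof.
move=> [d dP] [e eQ]; exists (d ++ e) => M v freeM.
rewrite dP // eQ //; split=> [[[c cd cv]|[c ce cv]]|[c /List.in_app_iff[]]].
- by exists c => //; apply/List.in_app_iff; left.
- by exists c => //; apply/List.in_app_iff; right.
- by move=> cd cv; left; exists c.
- by move=> ce cv; right; exists c.
Qed.

Lemma pp_definable_false n : @pp_definable n (fun _ _ => False).
Proof. by exists [::] => M v _; split=> // /dnf_sat_nil. Qed.

Lemma clause_sat_and n (c c' : pp_clause n) M (v : 'I_n -> M) :
  clause_sat (pp_conj c.1 c'.1, c.2 ++ c'.2) v <-> clause_sat c v /\ clause_sat c' v.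
Proof.
rewrite /clause_sat /= pp_conjP; split=> [[[cv c'v] nq]|[[cv nq] [c'v nq']]].
  by split; split=> // q qc; apply: nq; apply/List.in_app_iff; [left | right].
by split=> // q /List.in_app_iff[/nq|/nq'].
Qed.

Lemma pp_definable_and n (P Q : forall M, ('I_n -> M) -> Prop) :
  pp_definable P -> pp_definable Q -> pp_definable (fun M v => P M v /\ Q M v).
Proof.
move=> [d dP] [e eQ].
suff : pp_definable (fun M v => dnf_sat d v /\ dnf_sat e v).
  by apply: pp_definable_ext => M v freeM; rewrite dP // eQ.
have one c : pp_definable (fun M v => clause_sat c v /\ dnf_sat e v).
  elim: e {eQ} => [|c' e IHe].
    apply: pp_definable_ext (pp_definable_false n) => M v _.
    by split=> // -[_ /dnf_sat_nil].
  apply: pp_definable_ext (pp_definable_or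
    (pp_definable_clause (pp_conj c.1 c'.1, c.2 ++ c'.2)) IHe) => M v _.
  rewrite clause_sat_and dnf_sat_cons; tauto.
elim: d {dP} => [|c d IHd].
  apply: pp_definable_ext (pp_definable_false n) => M v _.
  by split=> // -[/dnf_sat_nil].
apply: pp_definable_ext (pp_definable_or (one c) IHd) => M v _.
rewrite dnf_sat_cons; tauto.
Qed.

Lemma pp_definable_not n (P : forall M, ('I_n -> M) -> Prop) :
  pp_definable P -> pp_definable (fun M v => ~ P M v).
Proof.
move=> [d dP]; suff : pp_definable (fun M (v : 'I_n -> M) => ~ dnf_sat d v).
  by apply: pp_definable_ext => M v freeM; rewrite dP.
elim: d {dP} => [|[p qs] d IHd].
  apply: pp_definable_ext (pp_definable_pp (pp_true R n)) => M v _.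
  by split=> [_ /dnf_sat_nil|_]; last exact: pp_trueP.
suff one : pp_definable (fun M (v : 'I_n -> M) => ~ clause_sat (p, qs) v).
  apply: pp_definable_ext (pp_definable_and one IHd) => M v _.
  rewrite dnf_sat_cons; tauto.
elim: qs => [|q qs IHqs].
  apply: pp_definable_ext (pp_definable_clause (pp_true R n, [:: p])) => M v _.
  split=> [[_ np] [/= pv _]|nc]; first by apply: np pv; left.
  split=> [|_ /= [<-|//] pv]; first exact: pp_trueP.
  by apply: nc; split=> // q [].
apply: pp_definable_ext (pp_definable_or (pp_definable_pp q) IHqs) => M v _.
split=> [[qv|nc] [/= pv nq]|nc]; first by apply: nq qv; left.
  by apply: nc; split=> // r rqs; apply: nq; right.
have [qv|nqv] := pselect (pp_sol q M v); first by left.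
right=> -[/= pv nq]; apply: nc; split=> // r [<-|rqs] //.
exact: nq.
Qed.

Lemma avoid_exceptions (T : Type) (s : seq T) (P : T -> nat -> Prop) :
  (forall q, List.In q s -> forall k l, P q k -> P q l -> k = l) ->
  exists K, forall k, (K <= k)%N -> forall q, List.In q s -> ~ P q k.
Proof.
elim: s => [|q s IHs] uniqP; first by exists 0%N => k _ q [].
have [|K KP] := IHs; first by move=> r rs; apply: uniqP; right.
have [[k0 k0P]|none] := pselect (exists k, P q k).
  exists (maxn K k0.+1) => k; rewrite geq_max => /andP[Kk k0k] r [<- Pk|rs].
    have kk0 : k = k0 by apply: uniqP Pk k0P; left.
    by rewrite kk0 ltnn in k0k.
  exact: KP.
exists K => k Kk r [<- Pk|rs]; first by apply: none; exists k.
exact: KP.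
Qed.

Lemma ext_valD M n (x y : M) (v w : 'I_n -> M) :
  ext_val (x + y) (fun i => v i + w i) = fun i => ext_val x v i + ext_val y w i.
Proof. by apply/funext => i; rewrite /ext_val; case: unliftP. Qed.

Lemma ext_valDl M n (x y : M) (v : 'I_n -> M) :
  ext_val (x + y) v = fun i => ext_val x v i + ext_val y (fun=> 0) i.
Proof.
by rewrite -ext_valD; congr ext_val; apply/funext => i; rewrite addr0.
Qed.

Lemma ext_valBl M n (x y : M) (v : 'I_n -> M) :
  ext_val (x - y) (fun=> 0) = fun i => ext_val x v i - ext_val y v i.
Proof.
apply/funext => i; rewrite /ext_val; case: unliftP => //= j _.
by rewrite subrr.
Qed.

Lemma pp_homog_elem1 M n (p : pp R n.+1) (x : M) :
  pp_sol (pp_homog p) M (elem1 x) <-> pp_sol p M (ext_val x (fun=> 0)).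
Proof. by rewrite pp_homogP. Qed.

Lemma pp_homog_diff M n (p : pp R n.+1) (x y : M) (v : 'I_n -> M) :
  pp_sol p M (ext_val x v) -> pp_sol p M (ext_val y v) ->
  pp_sol (pp_homog p) M (elem1 (x - y)).
Proof.
by move=> px py; apply/pp_homog_elem1; rewrite (ext_valBl x y v); exact: pp_solB.
Qed.

Definition homog_le n (p q : pp R n.+1) :=
  pp_sol (pp_homog p) R^o `<=` pp_sol (pp_homog q) R^o.

(** A new formula q is treated by means of an r in R that solves the homogeneous
    part of p but not that of q. The translates of y by the independent copies
    iota k r of r still solve p, and each coset that is to be avoided contains
    at most one of them. *)
Lemma avoid_cosets M n (p : pp R n.+1) (qs : seq (pp R n.+1)) (x : M) (v : 'I_n -> M) :
  free_like M -> (forall q, List.In q qs -> ~ homog_le p q) ->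
  pp_sol p M (ext_val x v) ->
  exists2 y, pp_sol p M (ext_val y v) &
    forall q, List.In q qs -> ~ pp_sol q M (ext_val y v).
Proof.
move=> [_ [iota [pi pi_iota]]]; elim: qs => [|q qs IHqs] npq px.
  by exists x => // q [].
have [|y py nqy] := IHqs _ px; first by move=> r rqs; apply: npq; right.
have [qy|nqy'] := pselect (pp_sol q M (ext_val y v)); last first.
  by exists y => // r [<-|/nqy].
have [r pr nqr] : exists2 r : R^o, pp_sol (pp_homog p) R^o (elem1 r) &
    ~ pp_sol (pp_homog q) R^o (elem1 r).
  apply: contrapT => none; apply: (npq q); first by left.
  move=> r pr; apply: contrapT => nqr; apply: none.
  have re : elem1 (r ord0) = r by apply/funext => i; rewrite (ord1 i).
  by exists (r ord0); rewrite re.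
pose z k := y + iota k r.
have pz k : pp_sol p M (ext_val (z k) v).
  rewrite /z ext_valDl; apply: pp_solD => //; apply/pp_homog_elem1.
  exact: (pp_sol_linear (iota k) pr).
have pi_homog k (q' : pp R n.+1) (u : M) :
    pp_sol (pp_homog q') M (elem1 u) -> pp_sol (pp_homog q') R^o (elem1 (pi k u)).
  exact: (pp_sol_linear (pi k)).
have [|K KP] := @avoid_exceptions _ qs (fun q' k => pp_sol q' M (ext_val (z k) v)).
  move=> q' q'qs k l q'k q'l; apply: contrapT => kl; apply: (nqy q') => //.
  have := pi_homog k _ _ (pp_homog_diff q'k q'l).
  rewrite /z opprD addrACA subrr add0r linearB !pi_iota eqxx.
  case: eqP => // _; rewrite subr0 => /(pp_sol_linear (iota k)) q'r.
  have := pp_solB q'k ((pp_homog_elem1 q' (iota k r)).1 q'r).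
  by rewrite /z ext_valDl; congr (pp_sol q' M _); apply/funext => i; rewrite addrK.
exists (z K) => // q' [<- qz|q'qs]; last exact: KP.
apply: nqr; have := pi_homog K _ _ (pp_homog_diff qz qy).
by rewrite /z addrAC subrr add0r pi_iota eqxx.
Qed.

Lemma pp_definable_ex_clause n (c : pp_clause n.+1) :
  pp_definable (fun M (v : 'I_n -> M) => exists x, clause_sat c (ext_val x v)).
Proof.
case: c => p qs; pose inc q := `[< homog_le p q >].
apply: pp_definable_ext (pp_definable_clause (pp_ex p,
  [seq pp_ex (pp_conj p q) | q <- List.filter inc qs])) => M v freeM.
split=> [[/= /pp_exP[x px] nq]|[x [/= px nq]]]; last first.
  split=> [|r /List.in_map_iff[q [<-]]]; first by apply/pp_exP; exists x.
  move=> /List.filter_In[qqs /asboolP pq] /pp_exP[y /pp_conjP[py qy]].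
  apply: (nq q qqs); have /freeM.1 sub := pq.
  have /pp_homog_elem1 := sub _ (pp_homog_diff px py).
  move=> /(pp_solD qy); congr (pp_sol q M _).
  by rewrite -ext_valDl addrC subrK.
have npq q : List.In q (List.filter (fun q => ~~ inc q) qs) -> ~ homog_le p q.
  by move=> /List.filter_In[_ /asboolPn].
have [y py nqy] := avoid_cosets freeM npq px.
exists y; split=> // q qqs qy; have [pq|pq] := boolP (inc q).
  apply: (nq (pp_ex (pp_conj p q))).
    by apply/List.in_map_iff; exists q; split=> //; apply/List.filter_In.
  by apply/pp_exP; exists y; apply/pp_conjP.
by apply: (nqy q) qy; apply/List.filter_In.
Qed.

Lemma pp_definable_ex n (P : forall M, ('I_n.+1 -> M) -> Prop) :
  pp_definable P -> pp_definable (fun M v => exists x, P M (ext_val x v)).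
Proof.
move=> [d dP].
suff : pp_definable (fun M (v : 'I_n -> M) => exists x, dnf_sat d (ext_val x v)).
  by apply: pp_definable_ext => M v freeM; split=> -[x Px]; exists x;
    move: Px; rewrite dP.
elim: d {dP} => [|c d IHd].
  apply: pp_definable_ext (pp_definable_false n) => M v _.
  by split=> // -[x /dnf_sat_nil].
apply: pp_definable_ext (pp_definable_or (pp_definable_ex_clause c) IHd) => M v _.
split=> [[[x cx]|[x dx]]|[x /dnf_sat_cons[cx|dx]]].
- by exists x; apply/dnf_sat_cons; left.
- by exists x; apply/dnf_sat_cons; right.
- by left; exists x.
- by right; exists x.
Qed.

Lemma eval_linear n (t : term R n) :
  exists c : 'I_n -> R, forall M (v : 'I_n -> M), eval v t = \sum_j c j *: v j.
Proof.
elim: t => [i||t [c cE] u [d dE]|r t [c cE]].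
- by exists (fun j => (j == i)%:R) => M v; rewrite sum_delta.
- by exists (fun=> 0) => M v; rewrite big1 // => j _; rewrite scale0r.
- exists (fun j => c j + d j) => M v; rewrite /= cE dE -big_split.
  by apply: eq_bigr => j _; rewrite scalerDl.
- exists (fun j => r * c j) => M v; rewrite /= cE scaler_sumr.
  by apply: eq_bigr => j _; rewrite scalerA.
Qed.

Theorem quantifier_elimination n (phi : formula R n) :
  pp_definable (fun M (v : 'I_n -> M) => sat phi v).
Proof.
elim: phi => {n} [n t u|n|n phi IHphi psi IHpsi|n phi IHphi] /=.
- have [c cE] := eval_linear t; have [d dE] := eval_linear u.
  apply: pp_definable_ext (pp_definable_pp (pp_eq0 (fun j => c j - d j))) => M v _.
  rewrite pp_eq0P cE dE; under eq_bigr do rewrite scalerBl; rewrite sumrB.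
  by split=> [/subr0_eq|->]; rewrite ?subrr.
- exact: pp_definable_false.
- apply: pp_definable_ext (pp_definable_or (pp_definable_not IHphi) IHpsi) => M v _.
  split=> [[]//|imp]; have [phiv|] := pselect (sat phi v); last by left.
  by right; exact: imp.
- apply: pp_definable_ext
    (pp_definable_not (pp_definable_ex (pp_definable_not IHphi))) => M v _.
  split=> [none x|all [x]]; last by apply; exact: all.
  by apply: contrapT => nphi; apply: none; exists x.
Qed.

End FreeLike.

Section Models.
Variable R : pzRingType.
Implicit Types (M N : lmodType R) (n : nat).

Definition FNot n (phi : formula R n) := FImp phi (FFalse R n).
Definition FAnd n (phi psi : formula R n) := FNot (FImp phi (FNot psi)).
Definition FOr n (phi psi : formula R n) := FImp (FNot phi) psi.
Definition FEx n (phi : formula R n.+1) := FNot (FAll (FNot phi)).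

Lemma sat_FAnd n (phi psi : formula R n) M v :
  sat (FAnd phi psi) (v : 'I_n -> M) <-> sat phi v /\ sat psi v.
Proof.
split=> [h|[phiv psiv] h]; last exact: h.
by apply: contrapT => nh; apply: h => phiv psiv; apply: nh.
Qed.

Lemma sat_FOr n (phi psi : formula R n) M v :
  sat (FOr phi psi) (v : 'I_n -> M) <-> sat phi v \/ sat psi v.
Proof.
split=> [h|[phiv nphi|psiv _] //].
  by have [phiv|nphi] := pselect (sat phi v); [left | right; exact: h].
by case: nphi.
Qed.

Lemma sat_FEx n (phi : formula R n.+1) M v :
  sat (FEx phi) (v : 'I_n -> M) <-> exists x, sat phi (ext_val x v).
Proof.
split=> [h|[x phix] h]; last exact: h phix.
by apply: contrapT => nh; apply: h => x phix; apply: nh; exists x.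
Qed.

Definition term_lin n k (c : 'I_k -> R) (s : 'I_k -> 'I_n) : term R n :=
  foldr (fun j t => TAdd (TScale (c j) (TVar R (s j))) t) (TZero R n) (enum 'I_k).

Lemma eval_term_lin n k (c : 'I_k -> R) (s : 'I_k -> 'I_n) M (v : 'I_n -> M) :
  eval v (term_lin c s) = \sum_j c j *: v (s j).
Proof.
rewrite -big_enum /term_lin; elim: (enum _) => [|j r IHr] /=.
  by rewrite big_nil.
by rewrite big_cons IHr.
Qed.

Definition formula_conj n (s : seq (formula R n)) : formula R n :=
  foldr (@FAnd n) (FNot (FFalse R n)) s.

Lemma sat_formula_conj n (s : seq (formula R n)) M (v : 'I_n -> M) :
  sat (formula_conj s) v <-> forall phi, List.In phi s -> sat phi v.
Proof.
elim: s => [|phi s IHs]; first by split=> [_ phi []|_ []].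
rewrite /formula_conj [foldr _ _ _]/= sat_FAnd IHs.
split=> [[phiv sv] psi [<-|/sv] //|sv].
by split=> [|psi ps]; apply: sv; [left | right].
Qed.

Fixpoint formula_ex k n : formula R (k + n) -> formula R n :=
  if k is k'.+1 then fun phi => formula_ex (FEx phi) else id.

Lemma ext_val_eta M n (w : 'I_n.+1 -> M) : ext_val (w ord0) (w \o lift ord0) = w.
Proof. by apply/funext => i; rewrite /ext_val; case: unliftP => [j|] ->. Qed.

Lemma sat_formula_ex k n (phi : formula R (k + n)) M (v : 'I_n -> M) :
  sat (formula_ex phi) v <->
  exists2 w : 'I_(k + n) -> M, (forall i, w (rshift k i) = v i) & sat phi w.
Proof.
elim: k phi => [|k IHk] phi /=.
  have rs0 i : rshift 0 i = i :> 'I_n by apply/val_inj.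
  split=> [phiv|[w wE]]; first by exists v => // i; rewrite rs0.
  by congr (sat phi _); apply/funext => i; rewrite -wE rs0.
have rsS i : rshift k.+1 i = lift ord0 (rshift k i : 'I_(k + n)) by apply/val_inj.
rewrite IHk; split=> [[w wE /sat_FEx[x phix]]|[w wE phiw]].
  by exists (ext_val x w) => // i; rewrite rsS ext_valS.
exists (w \o lift ord0) => [i|]; first by rewrite /= -rsS.
by apply/sat_FEx; exists (w ord0); rewrite ext_val_eta.
Qed.

Definition pp_formula n (phi : pp R n) : formula R n :=
  formula_ex (formula_conj [seq
    FEq (term_lin (fun j => pp_A phi i j) (lshift n))
        (term_lin (fun j => pp_B phi i j) (@rshift (pp_bound phi) n))
  | i <- enum 'I_(pp_eqs phi)]).

Lemma sat_pp_formula n (phi : pp R n) M (v : 'I_n -> M) :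
  sat (pp_formula phi) v <-> pp_sol phi M v.
Proof.
have In_enum k (i : 'I_k) : List.In i (enum 'I_k).
  have := mem_enum 'I_k i; rewrite inE; elim: (enum _) => //= j r IHr.
  by rewrite inE => /orP[/eqP->|/IHr]; [left | right].
rewrite sat_formula_ex; split=> [[w wE /sat_formula_conj eqs]|/pp_solP[y ey]].
  apply/pp_solP; exists (fun j => w (lshift n j)) => i.
  have /= := eqs _ (List.in_map _ _ _ (In_enum _ i)).
  rewrite !eval_term_lin => ->; apply: eq_bigr => j _; by rewrite wE.
have [w [wl wr]] := ord_cat y v; exists w => //.
apply/sat_formula_conj => _ /List.in_map_iff[i [<- _]] /=.
rewrite !eval_term_lin; under eq_bigr do rewrite wl.
by rewrite ey; apply: eq_bigr => j _; rewrite wr.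
Qed.

Definition dnf_formula n (d : seq (pp_clause R n)) : formula R n :=
  foldr (fun c => FOr (FAnd (pp_formula c.1)
    (formula_conj [seq FNot (pp_formula q) | q <- c.2]))) (FFalse R n) d.

Lemma sat_dnf_formula n (d : seq (pp_clause R n)) M (v : 'I_n -> M) :
  sat (dnf_formula d) v <-> dnf_sat d v.
Proof.
elim: d => [|c d IHd]; first by split=> // /dnf_sat_nil.
rewrite [dnf_formula _]/= sat_FOr sat_FAnd dnf_sat_cons IHd.
rewrite sat_pp_formula sat_formula_conj /clause_sat.
suff -> : (forall phi, List.In phi [seq FNot (pp_formula q) | q <- c.2] -> sat phi v)
    <-> (forall q, List.In q c.2 -> ~ pp_sol q M v) by [].
split=> [nq q qc /sat_pp_formula|nq _ /List.in_map_iff[q [<- qc]] /sat_pp_formula].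
  by apply: (nq (FNot (pp_formula q))); apply/List.in_map_iff; exists q.
exact: nq.
Qed.

Fixpoint universal_closure n : formula R n -> sentence R :=
  if n is n'.+1 then fun phi => universal_closure (FAll phi) else id.

Lemma holds_universal_closure n (phi : formula R n) M :
  holds M (universal_closure phi) <-> forall v : 'I_n -> M, sat phi v.
Proof.
elim: n phi => [//|n IHn] phi /=; rewrite IHn.
split=> [all w|all v x]; last exact: all.
by rewrite -(ext_val_eta w); exact: all.
Qed.

Lemma elementary_pp_type M N (f : M -> N) : elementary f ->
  forall n (a : 'I_n -> M), pp_type (f \o a) = pp_type a.
Proof.
move=> elf n a; apply/seteqP; split=> phi /=;
  by move=> /sat_pp_formula h; apply/sat_pp_formula/elf.
Qed.

Lemma elementary_iso M N (f : {linear M -> N}) : bijective f -> elementary f.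
Proof.
move=> [g fK gK] n phi.
have eval_f m (v : 'I_m -> M) (t : term R m) : eval (f \o v) t = f (eval v t).
  elim: t => [i||t IHt u IHu|r t IHt] //=.
  - by rewrite linear0.
  - by rewrite IHt IHu linearD.
  - by rewrite IHt linearZ.
elim: phi => {n} [n t u|n|n phi IHphi psi IHpsi|n phi IHphi] v //=.
- by rewrite !eval_f; split=> [->|/(can_inj fK)].
- by rewrite IHphi IHpsi.
have ext x : f \o ext_val x v = ext_val (f x) (f \o v).
  by apply/funext => i; rewrite /= /ext_val; case: unlift.
split=> all x; last by apply/IHphi; rewrite ext.
by rewrite -[x]gK -ext; apply/IHphi.
Qed.

Lemma elementary_model M N (f : M -> N) T : elementary f -> model T M -> model T N.
Proof.
move=> elf modM phi Tphi v; have v0 : 'I_0 -> M by case.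
rewrite (_ : v = f \o v0); first exact/elf/modM.
by apply/funext => -[].
Qed.

Lemma free_like_free_aleph0 : free_like (free_aleph0 R).
Proof.
split=> [phi psi|]; first exact/eq_flat_pp_implication/eq_flat_free.
exists (fun i => dinj (M := R^o) (i : {classic nat})).
exists (fun i => dcoord (M := R^o) (i : {classic nat})) => i j r.
by rewrite /= dcoord_dinj; congr (if _ then _ else _); apply/eqP/eqP.
Qed.

(** A sentence is equivalent, in free-like modules, to a Boolean combination of
    pp formulas without variables, and these are true in all modules. *)
Lemma free_like_model M : free_like M -> model (T_aleph0 R) M.
Proof.
move=> freeM phi Fphi v; have [d dP] := quantifier_elimination phi.
apply/dP => //; have v0 : 'I_0 -> free_aleph0 R by case.
have [c cd [_ nc]] := (dP _ v0 free_like_free_aleph0).1 (Fphi v0).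
exists c => //; split=> [|q qc]; first exact: pp_sol0.
by have := nc q qc (pp_sol0 q v0).
Qed.

(** The equivalence of a formula with its elimination is an axiom of T, so the
    truth of the formula in models of T depends on pp types only. *)
Lemma models_elementary M N (f : M -> N) :
  model (T_aleph0 R) M -> model (T_aleph0 R) N ->
  (forall n (a : 'I_n -> M), pp_type (f \o a) = pp_type a) -> elementary f.
Proof.
move=> modM modN fpp n phi v; have [d dP] := quantifier_elimination phi.
pose psi := FAnd (FImp phi (dnf_formula d)) (FImp (dnf_formula d) phi).
have Tpsi : T_aleph0 R (universal_closure psi).
  apply/holds_universal_closure => w; apply/sat_FAnd.
  by split=> /=; rewrite sat_dnf_formula dP //; exact: free_like_free_aleph0.
have elim (K : lmodType R) (w : 'I_n -> K) :
    model (T_aleph0 R) K -> sat phi w <-> dnf_sat d w.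
  move=> /(_ _ Tpsi)/holds_universal_closure/(_ w)/sat_FAnd[/= h h'].
  by rewrite -sat_dnf_formula; split.
have ppE q : pp_sol q M v <-> pp_sol q N (f \o v).
  by have := fpp n v => /seteqP[sub sup]; split=> h; [exact: sup | exact: sub].
rewrite !elim //; split=> -[c cd [cv nc]]; exists c => //; split.
- exact/ppE.
- by move=> q qc /ppE; exact: nc.
- exact/ppE.
- by move=> q qc /ppE; exact: nc.
Qed.

End Models.

(** * The matrix version of Bass' flat module *)

Section Products.
Variables (R : pzRingType) (M N : lmodType R).

Definition pair_inl (x : M) : M * N := (x, 0).
Definition pair_inr (y : N) : M * N := (0, y).

Lemma pair_inl_linear : linear pair_inl.
Proof. by move=> a x y; congr (_, _); rewrite /= scaler0 addr0. Qed.

Lemma pair_inr_linear : linear pair_inr.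
Proof. by move=> a x y; congr (_, _); rewrite /= scaler0 addr0. Qed.

HB.instance Definition _ :=
  GRing.isLinear.Build R M (M * N)%type _ pair_inl pair_inl_linear.
HB.instance Definition _ :=
  GRing.isLinear.Build R N (M * N)%type _ pair_inr pair_inr_linear.

Lemma pair_split (x : M * N) : x = pair_inl x.1 + pair_inr x.2.
Proof. by case: x => x y; congr (_, _); rewrite /= ?addr0 ?add0r. Qed.

Lemma eq_flat_prod : eq_flat M -> eq_flat N -> eq_flat (M * N)%type.
Proof.
move=> /eq_flatP flatM /eq_flatP flatN; apply/eq_flatP => n c m cm.
have [|k [D [w [mE cD]]]] := flatM n c (fst \o m).
  rewrite -[RHS](congr1 fst cm) [RHS](linear_sum fst).
  by apply: eq_bigr => i _.
have [|k' [D' [w' [mE' cD']]]] := flatN n c (snd \o m).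
  rewrite -[RHS](congr1 snd cm) [RHS](linear_sum snd).
  by apply: eq_bigr => i _.
have [y [yl yr]] := ord_cat (pair_inl \o w) (pair_inr \o w').
have /choice[E /all_and2[El Er]] i := ord_cat (D i) (D' i).
exists (k + k')%N, E, y; split=> [i|l].
  rewrite big_split_ord [LHS]pair_split; congr (_ + _).
    rewrite [(m i).1]mE linear_sum; apply: eq_bigr => l _.
    by rewrite El yl linearZ.
  rewrite [(m i).2]mE' linear_sum; apply: eq_bigr => l _.
  by rewrite Er yr linearZ.
by case: (split_ordP l) => {}l ->; under eq_bigr do rewrite ?(El, Er).
Qed.

Lemma generates_prod (I J : Type) (e : I -> M) (e' : J -> N) :
  generates (range e) -> generates (range e') ->
  generates (range (fun s : I + J =>
    match s with inl i => pair_inl (e i) | inr j => pair_inr (e' j) end)).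
Proof.
move=> gen gen' x.
have [n [c [g [gX xE]]]] := gen x.1; have [n' [c' [g' [gX' xE']]]] := gen' x.2.
have [d [dl dr]] := ord_cat c c'.
have [h [hl hr]] := ord_cat (pair_inl \o g) (pair_inr \o g').
exists (n + n')%N, d, h; split=> [i|].
  case: (split_ordP i) => {}i ->; rewrite ?hl ?hr /=.
    by have [j _ <-] := gX i; exists (inl j).
  by have [j _ <-] := gX' i; exists (inr j).
rewrite big_split_ord [LHS]pair_split xE xE' !linear_sum.
by congr (_ + _); apply: eq_bigr => i _; rewrite ?(dl, dr) ?(hl, hr) linearZ.
Qed.

End Products.

Section BassModule.
Variable R : pzRingType.
Notation F0 := (free_aleph0 R).

Definition basis_elt (i : nat) : F0 := dinj (i : {classic nat}) (1 : R^o).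

Lemma generates_basis : generates (range basis_elt).
Proof.
move=> x; have [k [C [b [_ xE _]]]] := free_tuple (fun _ : 'I_1 => x : F0).
exists k, (C ord0), (fun l => basis_elt (b l)); split; last exact: (xE ord0).
by move=> l; exists (b l).
Qed.

Lemma free_aleph0_map (K : lmodType R) k (z : 'I_k -> K) :
  exists h : {linear F0 -> K}, forall l : 'I_k, h (basis_elt l) = z l.
Proof.
pose zn (i : {classic nat}) : K := if insub (i : nat) is Some l then z l else 0.
exists (dsum_lift (fun i => scalar_map (zn i)) : {linear dsum nat R^o -> K}) => l.
by rewrite /= dsum_lift_dinj /= /scalar_map scale1r /zn valK.
Qed.

(** The limit B of a sequence of endomorphisms of F0, made into a model of the
    theory of F0 by adding F0. *)
Definition bass_model (f : nat -> {linear F0 -> F0}) : lmodType R :=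
  (seq_limit f * F0)%type.

Section BassModel.
Variable f : nat -> {linear F0 -> F0}.

Lemma eq_flat_bass_model : eq_flat (bass_model f).
Proof.
by apply: eq_flat_prod; [apply: eq_flat_seq_limit|]; exact: eq_flat_free.
Qed.

Lemma flat_bass_model : flat (bass_model f).
Proof. exact/eq_flat_flat/eq_flat_bass_model. Qed.

Lemma bass_model_T : model (T_aleph0 R) (bass_model f).
Proof.
apply: free_like_model; split=> [phi psi|].
  exact/eq_flat_pp_implication/eq_flat_bass_model.
have [_ [iota [pi pi_iota]]] := free_like_free_aleph0 R.
exists (fun i => @pair_inr R (seq_limit f) F0 \o iota i : {linear R^o -> bass_model f}).
exists (fun i => pi i \o snd : {linear bass_model f -> R^o}) => i j r /=.
exact: pi_iota.
Qed.

Lemma card_generated_bass_model (K : Type) : infinite_set [set: K] ->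
  card_generated K (bass_model f).
Proof.
move=> infK; eexists; split; last first.
  apply: generates_prod generates_basis.
  exact: generates_seq_limit generates_basis.
apply: card_le_trans (card_image_le _ _) _.
apply: card_le_trans (countableP _) _.
exact/infiniteP.
Qed.

End BassModel.

(** A descending chain of divisibility formulas A i | x comes with matrices C i
    such that A (i + 1) = A i C i. In the limit along the C i, the images of the
    A i times the basis are one and the same tuple a, which satisfies all of
    the formulas; a generator of pp(a) already holds at some stage m, hence is
    a consequence of A m | x. *)
Theorem dcc_pp_of_bass_models :
  (forall f, mittag_leffler (bass_model f)) -> dcc_pp (@dvd_formulas R).
Proof.
move=> ml K n gamma gammaP gammaS.
have /choice[kA kAE] i : exists kA : {k & 'M[R]_(n, k)}, gamma i = pp_dvd (tagged kA).
  by have [k [A ->]] := gammaP i; exists (Tagged (fun k => 'M[R]_(n, k)) A).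
pose alpha i p : F0 := \sum_l tagged (kA i) p l *: basis_elt l.
have alpha_map i (L : lmodType R) (z : 'I_(tag (kA i)) -> L) :
    exists h : {linear F0 -> L}, forall p,
      h (alpha i p) = \sum_l tagged (kA i) p l *: z l.
  have [h hE] := free_aleph0_map z; exists h => p; rewrite linear_sum.
  by apply: eq_bigr => l _; rewrite linearZ hE.
have /choice[f fE] i : exists g : {linear F0 -> F0},
    forall p, g (alpha i p) = alpha i.+1 p.
  have AC l : exists c : 'I_(tag (kA i)) -> R,
      forall p, tagged (kA i.+1) p l = \sum_j tagged (kA i) p j * c j.
    have := gammaS i R^o (fun p => tagged (kA i.+1) p l : R^o).
    rewrite !kAE => sub.
    have /sub/pp_dvdP[c cE] : pp_sol (pp_dvd (tagged (kA i.+1))) R^o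
        (fun p => tagged (kA i.+1) p l : R^o); last by exists c.
    apply/pp_dvdP; exists (fun j => (j == l)%:R : R^o) => p.
    rewrite (bigD1 l) //= eqxx regular_scale1 big1 ?addr0 // => j /negbTE->.
    by rewrite scaler0.
  have {AC}/choice[C CE] := AC.
  have [g gE] := alpha_map i F0 (fun j => \sum_l C l j *: basis_elt l).
  exists g => p; rewrite gE sum_scale_sum.
  by apply: eq_bigr => l _; rewrite CE.
have transition_alpha i p : transition f 0 i (alpha 0%N p) = alpha i p.
  by elim: i => [//|i IHi]; rewrite /= IHi add0n fE.
pose a p : bass_model f := pair_inl _ (to_limit f 0 (alpha 0%N p)).
have [phi phia phi_le] := ml f n a.
have gamma_alpha i : pp_sol (gamma i) F0 (alpha i).
  by rewrite kAE; apply/pp_dvdP; exists (fun l => basis_elt l).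
have gamma_a i : pp_sol (gamma i) (bass_model f) a.
  have := pp_sol_linear (@pair_inl R (seq_limit f) F0 \o to_limit f i) (gamma_alpha i).
  congr pp_sol; apply/funext => p /=.
  by rewrite /a (to_limit_shift _ 0 i) transition_alpha.
have [m] := pp_sol_seq_limit (pp_sol_linear fst phia).
move=> phi_alpha; exists m => i mi; apply/seteqP; split=> x.
  elim: i mi => [|i IHi]; first by rewrite leqn0 => /eqP->.
  rewrite leq_eqVlt => /orP[/eqP->//|mi /gammaS]; exact: IHi.
move=> gx; apply: (phi_le _ (gamma_a i)); move: gx.
rewrite kAE => /pp_dvdP[z xE]; have [h hE] := alpha_map m K z.
have := pp_sol_linear h phi_alpha; congr pp_sol; apply/funext => p /=.
by rewrite transition_alpha hE xE.
Qed.

Lemma dcc_right_ideals_of_dcc_pp :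
  dcc_pp (@dvd_formulas R) -> dcc_principal_right_ideals R.
Proof.
move=> dcc a desc; pose gamma i := pp_dvd (const_mx (a i) : 'M[R]_(1, 1)).
have gammaP i (M : lmodType R) (x : 'I_1 -> M) :
    pp_sol (gamma i) M x <-> exists y, x ord0 = a i *: y.
  split=> [/pp_dvdP[y xE]|[y xE]].
    by exists (y ord0); rewrite xE big_ord1 mxE.
  by apply/pp_dvdP; exists (fun=> y) => p; rewrite (ord1 p) big_ord1 mxE.
have [i|i M x /gammaP[y xE]|n stab] := dcc (R^o : lmodType R) 1%N gamma.
- by exists 1%N, (const_mx (a i)).
- apply/gammaP; have [|r ar] := desc i (a i.+1); first by exists 1; rewrite mulr1.
  by exists (r *: y); rewrite scalerA -ar.
exists n => i ni; apply/seteqP.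
have sol j r : principal_right_ideal (a j) r <->
    pp_sol (gamma j) R^o (fun=> r : R^o).
  by rewrite gammaP.
have e := stab i ni.
by split=> r /sol h; apply/sol; [rewrite -e | rewrite e].
Qed.

End BassModule.

(** * The equivalences *)

Section Summands.
Variables (R : pzRingType) (M F : lmodType R).

Lemma pp_type_summand (S : submodClosed F) : direct_summand S ->
  forall n (a : 'I_n -> submod S), pp_type ((val : submod S -> F) \o a) = pp_type a.
Proof.
move=> [S' [SS' SF]] n a; apply/seteqP; split=> phi /=; last first.
  exact: (pp_sol_linear (val : {linear submod S -> F})).
move=> /pp_solP[y ey].
have /choice[s sP] j : exists s : submod S, y j - val s \in S'.
  have [s [s' [sS s'S' yE]]] := SF (y j).
  by exists (exist _ s sS); rewrite yE /= addrC addKr.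
apply/pp_solP; exists s => i; apply: val_inj.
rewrite !raddf_sum /=; apply/subr0_eq/SS'.
  rewrite -scaleN1r addrC rpredD ?rpredZ ?rpred_sum // => j _.
    by rewrite rpredZ ?(valP (a j)).
  by rewrite rpredZ ?(valP (s j)).
suff -> : \sum_j pp_A phi i j *: val (s j) - \sum_j pp_B phi i j *: val (a j) =
    - (1 *: \sum_j pp_A phi i j *: (y j - val (s j))).
  by rewrite -scaleN1r rpredZ ?rpredZ ?rpred_sum // => j _; rewrite rpredZ.
rewrite scale1r -[X in _ - X]ey -sumrB -sumrN; apply: eq_bigr => j _.
by rewrite -scalerBr -scalerN opprB.
Qed.

Variables (f : {linear M -> F}) (g : {linear F -> M}).
Hypothesis fK : cancel f g.

Definition retract_image : {pred F} := fun y => f (g y) == y.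

Lemma retract_image_submod : submod_closed retract_image.
Proof.
split=> [|a x y /eqP xS /eqP yS]; apply/eqP; first by rewrite !linear0.
by rewrite !linearP xS yS.
Qed.

Definition retract_kernel : {pred F} := fun y => g y == 0.

Lemma retract_kernel_submod : submod_closed retract_kernel.
Proof.
split=> [|a x y /eqP xS /eqP yS]; apply/eqP; first exact: linear0.
by rewrite linearP xS yS scaler0 addr0.
Qed.

Lemma retract_summand : exists2 S : submodClosed F,
  direct_summand S & isomorphic M (submod S).
Proof.
pose S : submodClosed F := HB.pack_for (submodClosed F) retract_image
  (GRing.isSubmodClosed.Build R F retract_image retract_image_submod).
exists S.
  exists (HB.pack_for (submodClosed F) retract_kernel
    (GRing.isSubmodClosed.Build R F retract_kernel retract_kernel_submod)).
  split=> [x /eqP fgx /eqP gx|x].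
    by rewrite -fgx gx linear0.
  exists (f (g x)), (x - f (g x)); split; last by rewrite addrC subrK.
    by apply/eqP; rewrite fK.
  by apply/eqP; rewrite linearB fK subrr.
have fS x : f x \in retract_image by apply/eqP; rewrite fK.
pose h x : submod S := exist _ (f x) (fS x).
have hlin : linear h by move=> a x y; apply: val_inj; rewrite /= linearP.
exists (HB.pack_for {linear M -> submod S} h
  (GRing.isLinear.Build R M _ _ h hlin)).
exists (fun y => g (val y)) => [x|y]; first exact: fK.
by apply: val_inj => /=; have /eqP := valP y.
Qed.

End Summands.

Section Equivalences.
Variables (R : pzRingType) (K : Type) (N : lmodType R).
Hypothesis infK : infinite_set [set: K].
Hypothesis projN : projective N.
Variables (q : {linear N -> R^o}) (j : {linear R^o -> N}).
Hypothesis jK : cancel j q.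
Local Notation F := (dsum K N).

Lemma projective_target : projective F.
Proof. exact: projective_dsum. Qed.

Lemma card_le_inj (T : Type) (A : set T) :
  (A #<= [set: K])%card -> exists u : T -> K, {in A &, injective u}.
Proof.
elim/Ppointed: K infK => [L infL|L _].
  by case: infL; rewrite emptyE; exact: finite_set0.
by move=> /pcard_injP.
Qed.

Lemma free_like_target : free_like F.
Proof.
split=> [phi psi|].
  exact/eq_flat_pp_implication/projective_eq_flat/projective_target.
have /infiniteP/card_le_inj[u uinj] := infK.
exists (fun i => dinj (u i : {classic K}) \o j : {linear R^o -> F}).
exists (fun i => q \o dcoord (u i : {classic K}) : {linear F -> R^o}) => i l r /=.
rewrite dcoord_dinj (_ : (u i == u l :> {classic K}) = (i == l)).
  by case: ifP; rewrite ?jK ?linear0.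
by apply/eqP/eqP => [/uinj|->] //; apply; rewrite in_setT.
Qed.

Lemma model_target : model (T_aleph0 R) F.
Proof. exact/free_like_model/free_like_target. Qed.

(** A module with at most K generators is an image of F, through the quotients
    N -> R of the summands. *)
Lemma projective_retract_target (M : lmodType R) :
  card_generated K M -> projective M ->
  exists (f : {linear M -> F}) (g : {linear F -> M}), cancel f g.
Proof.
move=> [X [XK gen]] projM; have [u uinj] := card_le_inj XK.
have /choice[v vP] k : exists m : M, forall x, X x -> u x = k -> m = x.
  have [[x [Xx <-]]|none] := pselect (exists x, X x /\ u x = k).
    by exists x => y Xy /esym; apply: uinj; rewrite inE.
  by exists 0 => x Xx ux; case: none; exists x.
pose g : {linear F -> M} := dsum_lift (fun k : {classic K} => scalar_map (v k) \o q).
have [|f fK] := @projective_section _ _ _ g projM; last by exists f, g.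
move=> x; have [n [c [h [hX ->]]]] := gen x.
exists (\sum_i c i *: dinj (u (h i) : {classic K}) (j 1)); rewrite linear_sum.
apply: eq_bigr => i _; rewrite linearZ /g /= dsum_lift_dinj /= jK /scalar_map scale1r.
by rewrite (vP (u (h i)) (h i)).
Qed.

Let dcc_of_ml : (forall M : lmodType R, card_generated K M -> flat M ->
    model (T_aleph0 R) M -> mittag_leffler M) -> dcc_pp (@dvd_formulas R).
Proof.
move=> ml; apply: dcc_pp_of_bass_models => f; apply: ml.
- exact: card_generated_bass_model.
- exact: flat_bass_model.
- exact: bass_model_T.
Qed.

Let ml_target : mittag_leffler F.
Proof. exact/projective_mittag_leffler/projective_target. Qed.

Let ml_of_iso_summand (M : lmodType R) (S : submodClosed F) :
  direct_summand S -> isomorphic M (submod S) -> mittag_leffler M.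
Proof.
move=> sumS [f fbij]; apply: (mittag_leffler_pp_type (f := val \o f)) ml_target.
move=> n a; rewrite -[RHS](elementary_pp_type (elementary_iso fbij)).
exact: (pp_type_summand sumS (f \o a)).
Qed.

Theorem equivalences_target : equivalences K F.
Proof.
have perfect : dcc_pp (@dvd_formulas R) -> left_perfect R.
  by move=> /dcc_right_ideals_of_dcc_pp; exact: dcc_left_perfect.
have perfect_summand : left_perfect R -> flat_summand K F.
  move=> perf M cM /perf projM.
  have [f [g fK]] := projective_retract_target cM projM.
  exact: retract_summand fK.
have perfect_pure : left_perfect R -> flat_pure K F.
  move=> perf M cM /perf projM.
  have [f [g fK]] := projective_retract_target cM projM.
  by exists f; split; [exact: can_inj fK | exact: pp_type_retract fK].
have dcc_models_ML : all_flat_models_ML R -> dcc_pp (@dvd_formulas R).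
  by move=> ml; apply: dcc_of_ml => M _; exact: ml.
have dcc_models_proj : flat_models_projective R K -> dcc_pp (@dvd_formulas R).
  move=> proj; apply: dcc_of_ml => M cM flatM modM.
  by apply: projective_mittag_leffler; exact: proj.
have dcc_summand : flat_summand K F -> dcc_pp (@dvd_formulas R).
  move=> summ; apply: dcc_of_ml => M cM flatM _.
  by have [S] := summ M cM flatM; exact: ml_of_iso_summand.
have dcc_elementary_summand :
    flat_models_elementary_summand K F -> dcc_pp (@dvd_formulas R).
  move=> summ; apply: dcc_of_ml => M cM flatM modM.
  by have [S [sumS _]] := summ M cM flatM modM; exact: ml_of_iso_summand.
have dcc_pure : flat_pure K F -> dcc_pp (@dvd_formulas R).
  move=> pure; apply: dcc_of_ml => M cM flatM _.
  by have [f [_ fpp]] := pure M cM flatM; exact: mittag_leffler_pp_type fpp ml_target.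
have dcc_elementary : flat_models_elementary K F -> dcc_pp (@dvd_formulas R).
  move=> elem; apply: dcc_of_ml => M cM flatM modM.
  have [f /elementary_pp_type fpp] := elem M cM flatM modM.
  exact: mittag_leffler_pp_type fpp ml_target.
rewrite /equivalences; tfae.
- by move=> /perfect perf M /perf; exact: projective_mittag_leffler.
- by move=> ml M flatM _; exact: ml.
- by move=> /dcc_models_ML/perfect perf M _; exact: perf.
- by move=> proj M cM flatM _; exact: proj.
- by move=> /dcc_models_proj/perfect; exact: perfect_summand.
- move=> summ M cM flatM modM; have [S sumS isoM] := summ M cM flatM.
  exists S; split=> //; have [f fbij] := isoM.
  apply: models_elementary model_target (pp_type_summand sumS).
  exact: elementary_model (elementary_iso fbij) modM.
- by move=> /dcc_elementary_summand/perfect; exact: perfect_pure.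
- move=> pure M cM flatM modM; have [f [_ fpp]] := pure M cM flatM.
  by exists f; exact: models_elementary model_target fpp.
- by move=> /dcc_elementary/perfect.
- by move=> perf; apply/dcc_right_ideals_of_dcc_pp/dcc_summand/perfect_summand.
- by move=> /dcc_left_perfect/perfect_summand/dcc_summand.
Qed.

End Equivalences.

Theorem corollary13 (R : pzRingType) :
  equivalences nat (free_aleph0 R) /\
  (forall kappa : Type, infinite_set [set: kappa]%classic ->
     equivalences kappa (dsum kappa (free_aleph0 R))).
Proof.
split=> [|kappa infK].
  apply: (@equivalences_target R nat R^o infinite_nat (@projective_regular R)
    idfun idfun) => //.
pose q : {linear free_aleph0 R -> R^o} := dcoord (M := R^o) (0%N : {classic nat}).
pose j : {linear R^o -> free_aleph0 R} := dinj (M := R^o) (0%N : {classic nat}).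
have jK : cancel j q by move=> r; rewrite /= dcoord_dinj eqxx.
exact: (@equivalences_target R kappa (free_aleph0 R) infK
  (projective_dsum (I := nat) (@projective_regular R)) q j jK).
Qed.
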